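(* Let $0<\epsilon<1$, $L_1^{\bullet}>0$, and let $v_1\in\mathrm{Affine}$ satisfy $c\cdot v_1<c\cdot e$ and $\lambda_{\min}(v_1)=1/4$; let $z_1:=c\cdot v_1$. Then the algorithm MainAlgo (run with input $\epsilon$, $v_1$ and with the fixed estimate $L_1^{\bullet}$) produces an iterate $x_k$ for which $\pi_k:=\pi(x_k)$ satisfies $$\frac{c\cdot\pi_k-z^*}{c\cdot e-z^*}\le\epsilon ,$$ and does so within computing a total number of gradients not exceeding $$O\left(\frac{\mathrm{Diam}_{z_1}\sqrt{L_1\ln n}}{\epsilon}+\left(1+\log\frac{c\cdot e-z^*}{c\cdot e-z_1}\right)\cdot\left(1+\mathrm{Diam}_{z_1}\sqrt{L_1\ln n}+\left|\log\frac{L_1^{\bullet}}{L_1}\right|\right)\right),$$ where the constant hidden in $O(\cdot)$ is universal.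
   Context: Hyperbolicity cone. Let $\mathcal{E}$ be a finite-dimensional real Euclidean space and $\mathcal{K}\subsetneq\mathcal{E}$ a closed convex cone with nonempty interior that is a hyperbolicity cone: there is a real homogeneous polynomial $p:\mathcal{E}\to\mathbb{R}$ (a hyperbolic polynomial for $\mathcal{K}$) such that (1) $\mathrm{int}(\mathcal{K})$ is a connected component of $\{x:p(x)\neq0\}$, and (2) for some (equivalently, every) $e\in\mathrm{int}(\mathcal{K})$ and all $x\in\mathcal{E}$, the univariate polynomial $\lambda\mapsto p(x-\lambda e)$ has only real roots. Fix such $p$, with degree $n\ge2$. The problem HP. Let $u\cdot v$ be an inner product on $\mathcal{E}$, let $c\in\mathcal{E}$, and let $\mathrm{Affine}\subseteq\mathcal{E}$ be an affine space. HP is: $\min c\cdot x$ subject to $x\in\mathrm{Affine}$, $x\in\mathcal{K}$. Assume $c$ is not orthogonal to the subspace of which $\mathrm{Affine}$ is a translate, and that HP has an optimal solution; $z^*$ is its optimal value. Fix $e\in\mathrm{Affine}\cap\mathrm{int}(\mathcal{K})$ (the distinguished direction). The eigenvalues $\lambda_1(x),\dots,\lambda_n(x)$ of $x\in\mathcal{E}$ are the roots of $\lambda\mapsto p(x-\lambda e)$, with multiplicity, and $\lambda_{\min}(x)=\min_j\lambda_j(x)$ (equivalently $\inf\{\lambda:x-\lambda e\notin\mathcal{K}\}$). For $x$ with $\lambda_{\min}(x)<1$ (in particular for every $x\in\mathrm{Affine}$ with $c\cdot x<c\cdot e$), $\pi(x):=e+\frac{1}{1-\lambda_{\min}(x)}(x-e)$.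 For $z\in\mathbb{R}$, $\mathrm{Affine}_z:=\{x\in\mathrm{Affine}:c\cdot x=z\}$; $\mathcal{L}$ is the subspace of which the sets $\mathrm{Affine}_z$ are translates. Smoothing. For $\mu>0$, $\hat f_\mu(x):=-\mu\ln\sum_{j=1}^n\exp(-\lambda_j(x)/\mu)$, a smooth concave function. Computational inner product. $\langle\;,\;\rangle$ is an inner product on $\mathcal{E}$ (possibly different from $u\cdot v$) with norm $\|v\|=\langle v,v\rangle^{1/2}$; gradients $\nabla$ and the orthogonal projection $P_{\mathcal{L}}$ onto $\mathcal{L}$ are with respect to it. Define $$L_1=\sup_{u\in\mathcal{E}}\ \sup\left\{\frac{\|P_{\mathcal{L}}\nabla\hat f_1(u+v)-P_{\mathcal{L}}\nabla\hat f_1(u+w)\|}{\|v-w\|}:v,w\in\mathcal{L},\ v\neq w\right\},$$ assumed positive. Let $\mathrm{diam}_z:=\sup\{\|x-y\|:x,y\in\mathrm{Affine}_z\cap\mathcal{K}\}$ (equal to $-\infty$ if $\mathrm{Affine}_z\cap\mathcal{K}=\emptyset$), and $\mathrm{Diam}_{z_1}=\max\{\mathrm{diam}_z:z\le z_1\}$. Algorithm AGM$(\mu,x_0)$, for $\mu>0$ and $x_0\in\mathrm{Affine}$ with $c\cdot x_0<c\cdot e$, with a fixed estimate $L_1^{\bullet}>0$ of $L_1$: (0) Initialize $L=L_1^{\bullet}/\mu$, $v=x_0$, $A=0$, $k=0$. (1) Compute $a=\frac{1+\sqrt{1+2AL}}{L}$, $y=\frac{A}{A+a}x_k+\frac{a}{A+a}v$,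 $x=y+\frac1LP_{\mathcal{L}}\nabla\hat f_\mu(y)$. (2) If $\langle\nabla\hat f_\mu(x),y-x\rangle>-\frac1L\|P_{\mathcal{L}}\nabla\hat f_\mu(x)\|^2$, let $L\leftarrow2L$ and return to (1). (3) Define $x_{k+1}=x$ and let $v\leftarrow v+aP_{\mathcal{L}}\nabla\hat f_\mu(x)$, $L\leftarrow L/2$, $A\leftarrow A+a$, $k\leftarrow k+1$; go to (1). The gradients computed are the evaluations $\nabla\hat f_\mu(y)$ and $\nabla\hat f_\mu(x)$ made on each pass through (1)-(2), including rejected passes. MainAlgo. Input: $0<\epsilon<1$, and $v_1\in\mathrm{Affine}$ with $c\cdot v_1<c\cdot e$, $\lambda_{\min}(v_1)=1/4$. Fix $\mu_1=1/(12\ln n)$, $\mu_2=\epsilon/(6\ln n)$; set $\ell=1$. (1) Start, in parallel, $\mathrm{AGM}_1:=\mathrm{AGM}(\mu_1,v_\ell)$ and $\mathrm{AGM}_2:=\mathrm{AGM}(\mu_2,v_\ell)$, letting them run indefinitely unless an iterate $w_j$ of $\mathrm{AGM}_1$ is obtained with $\lambda_{\min}(w_j)\ge1/2$, in which case go to (2). (2) For that $w_j$, let $v_{\ell+1}:=e+\frac34\cdot\frac{1}{1-\lambda_{\min}(w_j)}(w_j-e)$, let $\ell\leftarrow\ell+1$, and go to (1), restarting $\mathrm{AGM}_1$ and $\mathrm{AGM}_2$ with the new $v_\ell$ (with $\mu_1,\mu_2$, $L_1^{\bullet}$ unchanged). The iterates $w_1,w_2,\dots$ of $\mathrm{AGM}_1$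 and $x_1,x_2,\dots$ of $\mathrm{AGM}_2$ are indexed consecutively, the indexing not being restarted when the methods are restarted. It is assumed that $\mathrm{AGM}_1$ and $\mathrm{AGM}_2$ compute gradients simultaneously, so that at any time both have computed the same number of gradients. *)

(* Defs.v *)
From HB Require Import structures.
From mathcomp Require Import all_boot all_order all_algebra.
From mathcomp Require Import all_classical all_reals all_analysis.
From mathcomp Require Import (canonicals, coercions) mpoly complex.

Set Implicit Arguments.
Unset Strict Implicit.
Unset Printing Implicit Defensive.

Import Order.TTheory GRing.Theory Num.Theory.
Import numFieldNormedType.Exports.

Local Open Scope classical_set_scope.
Local Open Scope ring_scope.

(* The Euclidean space is 'rV[R]_m with its standard topology; every inner
   product on it is an arbitrary one, of type {dot 'rV[R]_m for idfun}. *)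

Section HyperbolicPolynomials.
Variables (R : realType) (m : nat) (p : mpoly.mpoly m R).
Implicit Types (x e : 'rV[R]_m) (K : set 'rV[R]_m).

Definition peval x : R := mpoly.meval (x 0) p.

(* the univariate polynomial p (x - 'X e) *)
Definition eig_poly e x : {poly R} :=
  mpoly.mmap polyC (fun i => (x 0 i)%:P - e 0 i *: 'X) p.

Definition only_real_roots (q : {poly R}) : Prop :=
  forall z : complex.complex R,
    root (map_poly (complex.real_complex R) q) z -> complex.Im z = 0.

Definition solid_closed_convex_cone K : Prop :=
  [/\ closed K, convex_set K,
      forall x (t : R), 0 <= t -> K x -> K (t *: x), K° !=set0 & K != setT].

Definition hyperbolicity_cone (n : nat) K : Prop :=
  [/\ solid_closed_convex_cone K, p \is mpoly.ishomog1 n (@mpoly.mdeg m),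
      (exists2 x0, peval x0 != 0 &
        K° = connected_component [set x | peval x != 0] x0) &
      (exists2 e, K° e & forall x, only_real_roots (eig_poly e x))].

(* The roots with multiplicity, in an unspecified order. *)
Definition eigenvalues e x : seq R :=
  xget [::] [set s : seq R | eig_poly e x =
    lead_coef (eig_poly e x) *: \prod_(r <- s) ('X - r%:P)].

Definition lambda_min e x : R :=
  \big[Num.min/head 0 (eigenvalues e x)]_(r <- eigenvalues e x) r.

Definition radial_proj e x : 'rV[R]_m :=
  e + (1 - lambda_min e x)^-1 *: (x - e).

Definition fhat e (mu : R) x : R :=
  - mu * ln (\sum_(r <- eigenvalues e x) expR (- r / mu)).

End HyperbolicPolynomials.

Section InnerProduct.
Variables (R : realType) (m : nat) (ip : {dot 'rV[R]_m for idfun}).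
Implicit Types (x v : 'rV[R]_m) (L : set 'rV[R]_m).

Definition ipnorm v : R := Num.sqrt (ip v v).

Definition grad (f : 'rV[R]_m -> R) x : 'rV[R]_m :=
  xget 0 [set g | differentiable f x /\ forall v, 'd f x v = ip g v].

Definition ortho_proj L v : 'rV[R]_m :=
  xget 0 [set u | L u /\ forall w, L w -> ip (v - u) w = 0].

End InnerProduct.

Section Program.
Variables (R : realType) (m : nat) (dot : {dot 'rV[R]_m for idfun}).
Variables (c : 'rV[R]_m) (Affine K : set 'rV[R]_m).
Implicit Types (x : 'rV[R]_m) (D : {vspace 'rV[R]_m}).

Definition is_translate D : Prop := exists a, Affine = [set x | x - a \in D].

Definition optimal_value (zstar : R) : Prop :=
  (exists x, [/\ Affine x, K x & dot c x = zstar]) /\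
  (forall x, Affine x -> K x -> zstar <= dot c x).

Definition level_space D : set 'rV[R]_m := [set d | d \in D /\ dot c d = 0].

Definition Affine_at (z : R) : set 'rV[R]_m := [set x | Affine x /\ dot c x = z].

Variable ip : {dot 'rV[R]_m for idfun}.

Definition diam (z : R) : \bar R :=
  ereal_sup [set (ipnorm ip (xy.1 - xy.2))%:E | xy in
    (Affine_at z `&` K) `*` (Affine_at z `&` K)].

Definition Diam (z1 : R) : \bar R :=
  ereal_sup [set diam z | z in [set z | z <= z1]].

End Program.

Section Algorithms.
Variables (R : realType) (m n : nat) (p : mpoly.mpoly m R).
Variables (e : 'rV[R]_m) (ip : {dot 'rV[R]_m for idfun}) (L : set 'rV[R]_m).
Implicit Types (x v w : 'rV[R]_m) (mu : R).

Definition grad_fhat mu x : 'rV[R]_m := grad ip (fhat p e mu) x.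

Definition pgrad_fhat mu x : 'rV[R]_m := ortho_proj ip L (grad_fhat mu x).

Definition lip_const : \bar R :=
  ereal_sup (range (fun u : 'rV[R]_m =>
    ereal_sup [set (ipnorm ip (pgrad_fhat 1 (u + vw.1) - pgrad_fhat 1 (u + vw.2))
                    / ipnorm ip (vw.1 - vw.2))%:E | vw in
      [set vw | [/\ L vw.1, L vw.2 & vw.1 != vw.2]]])).

Variable Lest : R.

Record agm_state := AgmState
  { agm_L : R; agm_v : 'rV[R]_m; agm_A : R; agm_x : 'rV[R]_m }.

Definition agm_init mu x0 : agm_state := AgmState (Lest / mu) x0 0 x0.

(* One pass through steps (1)-(2), followed by (3) when the point x is accepted,
   in which case x is returned as the new iterate. A pass evaluates two
   gradients, at y and at x. *)
Definition agm_pass mu (s : agm_state) : agm_state * option 'rV[R]_m :=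
  let: AgmState L_ v A xk := s in
  let a := (1 + Num.sqrt (1 + 2 * A * L_)) / L_ in
  let y := (A / (A + a)) *: xk + (a / (A + a)) *: v in
  let x := y + L_^-1 *: pgrad_fhat mu y in
  if ip (grad_fhat mu x) (y - x) > - L_^-1 * ipnorm ip (pgrad_fhat mu x) ^+ 2
  then (AgmState (2 * L_) v A xk, None)
  else (AgmState (L_ / 2) (v + a *: pgrad_fhat mu x) (A + a) x, Some x).

Definition grads_per_pass : nat := 2.

Variable eps : R.

Definition mu1 : R := 1 / (12 * ln n%:R).
Definition mu2 : R := eps / (6 * ln n%:R).

(* main_iters1 and main_iters2 list, in order, the iterates w_1, w_2, ... of the
   first method and x_1, x_2, ... of the second one, across all restarts;
   main_grads counts the gradients computed by both methods together. *)
Record main_state := MainState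
  { main_agm1 : agm_state; main_agm2 : agm_state;
    main_iters1 : seq 'rV[R]_m; main_iters2 : seq 'rV[R]_m;
    main_grads : nat }.

Definition main_init v1 : main_state :=
  MainState (agm_init mu1 v1) (agm_init mu2 v1) [::] [::] 0.

Definition restart_point w : 'rV[R]_m :=
  e + (3 / 4 * (1 - lambda_min p e w)^-1) *: (w - e).

(* The two methods make their passes in lockstep, which is what simultaneous
   gradient computations amount to, all passes having the same cost. *)
Definition main_step (s : main_state) : main_state :=
  let: (s1, o1) := agm_pass mu1 (main_agm1 s) in
  let: (s2, o2) := agm_pass mu2 (main_agm2 s) in
  let ws := main_iters1 s ++ seq_of_opt o1 in
  let xs := main_iters2 s ++ seq_of_opt o2 in
  let k := (main_grads s + (grads_per_pass + grads_per_pass))%N in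
  let continue := MainState s1 s2 ws xs k in
  if o1 is Some w then
    if 1 / 2 <= lambda_min p e w then
      let v := restart_point w in
      MainState (agm_init mu1 v) (agm_init mu2 v) ws xs k
    else continue
  else continue.

Definition main_run v1 (t : nat) : main_state := iter t main_step (main_init v1).

End Algorithms.

(* Main.v *)
Require Import Defs.
From HB Require Import structures.
From mathcomp Require Import all_boot all_order all_algebra.
From mathcomp Require Import all_classical all_reals all_analysis.
From mathcomp Require Import (canonicals, coercions) mpoly complex.
From mathcomp Require Import fingroup perm ring lra zify.

Set Implicit Arguments.
Unset Strict Implicit.
Unset Printing Implicit Defensive.

Import Order.TTheory GRing.Theory Num.Theory.
Import numFieldNormedType.Exports.

Local Open Scope classical_set_scope.
Local Open Scope ring_scope.

(* On a slice of Affine where c . x = z < c . e, the hyperbolic program amounts to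
   maximizing the concave function lambda_min, which f_mu approximates from below
   within mu ln n.

   f_mu is concave: by Gibbs' variational formula it is the minimum over the
   positive probability weights w of min_s sum_j w_j lambda_(s j) + mu sum_j w_j ln w_j,
   s ranging over the permutations, and min_s sum_j w_j lambda_(s j) is the smallest
   eigenvalue of another hyperbolic polynomial, hence concave by Garding's theorem.
   It is differentiable because exp differs from its Hermite interpolant at the
   eigenvalues of x by O(Q), where Q is the square of the characteristic polynomial,
   and symmetric polynomials of the eigenvalues are polynomials in x.

   The accelerated method therefore has an error at most |x - x_0|^2 / (2 A_k), with
   A_k growing quadratically once the line search has settled, after a logarithmic
   number of passes. Put s = (c . e - z) / (c . e - z^* ), so that 1 - s is the largest
   lambda_min on the slice. While s <= 1/3 the first method soon causes a restart,
   which multiplies s by at least 3/2; as s <= 3/4 at every start, at most two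
   phases have s > 1/3, and then the second method soon reaches the accuracy eps. *)

(** * Roots of polynomial families in a half plane *)

(** Single eigenvalues need be neither concave nor differentiable; only their symmetric functions
    are polynomials in x. So concavity is obtained from a product over all permutations, and
    differentiability by comparing a sum of exponentials with polynomials in x.

    The constants come from two error budgets. As mu_1 ln n = 1/12, smoothing and optimization each
    lose at most 1/12, so that on a slice with s <= 1/3 the first method reaches lambda_min >= 1 -
    1/3 - 1/6 = 1/2; a restart then scales the distance to e by (3/4) / (1 - lambda_min) >= 3/2. The
    radial projection of x has relative gap (1 - s - lambda_min x) / (1 - lambda_min x). As mu_2 ln
    n = eps/6, the second method makes the numerator at most eps/3, while the denominator is at
    least s > 1/3. *)

Section ComplexNorm.
Variable R : realType.
Local Notation C := (complex.complex R).
Local Notation ri := (complex.real_complex R).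
Local Notation normc := (@complex.ComplexField.Normc.normc R).
Implicit Types (x y z : C).

Lemma normc_ge0 x : 0 <= normc x.
Proof. by case: x => a b /=; exact: sqrtr_ge0. Qed.

Lemma normcM x y : normc (x * y) = normc x * normc y.
Proof. exact: complex.ComplexField.Normc.normcM. Qed.

Lemma normc0 : normc 0 = 0.
Proof. exact: complex.ComplexField.Normc.normc0. Qed.

Lemma normc1 : normc 1 = 1.
Proof. exact: complex.ComplexField.Normc.normc1. Qed.

Lemma le_normcD x y : normc (x + y) <= normc x + normc y.
Proof. exact: complex.le_normcD. Qed.

Lemma normc_real (r : R) : normc (ri r) = `|r|.
Proof. by rewrite /= expr0n addr0 sqrtr_sqr. Qed.

Lemma normc_eq0 x : (normc x == 0) = (x == 0).
Proof.
apply/eqP/eqP => [|->]; first exact: complex.ComplexField.Normc.eq0_normc.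
exact: normc0.
Qed.

Lemma normc_gt0 x : (0 < normc x) = (x != 0).
Proof. by rewrite lt_neqAle normc_ge0 eq_sym normc_eq0 andbT. Qed.

Lemma normc_ge_Im x : `|complex.Im x| <= normc x.
Proof.
case: x => a b /=; rewrite -sqrtr_sqr ler_wsqrtr //.
by rewrite lerDr sqr_ge0.
Qed.

Lemma normcX x k : normc (x ^+ k) = normc x ^+ k.
Proof.
elim: k => [|k IH]; first by rewrite !expr0 normc1.
by rewrite !exprS normcM IH.
Qed.

Lemma normc_sum (I : Type) (s : seq I) (F : I -> C) :
  normc (\sum_(i <- s) F i) <= \sum_(i <- s) normc (F i).
Proof.
elim: s => [|i s IH]; first by rewrite !big_nil normc0.
by rewrite !big_cons (le_trans (le_normcD _ _)) // lerD2l.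
Qed.

Lemma normc_prod (I : Type) (s : seq I) (F : I -> C) :
  normc (\prod_(i <- s) F i) = \prod_(i <- s) normc (F i).
Proof.
elim: s => [|i s IH]; first by rewrite !big_nil normc1.
by rewrite !big_cons normcM IH.
Qed.

End ComplexNorm.

Section RootsInHalfPlane.
Variable R : realType.
Local Notation C := (complex.complex R).
Local Notation normc := (@complex.ComplexField.Normc.normc R).
Local Notation Im := complex.Im.
Implicit Types (z : C) (f : {poly C}).

Lemma poly_factor_size f (d : nat) (c : C) :
  c != 0 -> (size f <= d.+1)%N -> f`_d = c ->
  exists2 s : d.-tuple C, f = c *: \prod_(w <- s) ('X - w%:P)
    & forall z, root f z = (z \in s).
Proof.
move=> c0 sz fd.
have szf : size f = d.+1.
  apply/eqP; rewrite eqn_leq sz ltnNge; apply/negP => le.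
  by move: c0; rewrite -fd nth_default ?eqxx.
have [r fE] := closed_field_poly_normal f.
have lc : lead_coef f = c by rewrite /lead_coef szf.
rewrite lc in fE.
have szr : size r == d.
  by move: szf; rewrite fE size_scale // size_prod_XsubC => -[->].
exists (Tuple szr) => //= z.
by rewrite fE rootZ // root_prod_XsubC.
Qed.

Lemma horner_roots_prod (d : nat) (c z : C) (s : d.-tuple C) :
  normc (c *: \prod_(w <- s) ('X - w%:P)).[z] =
  normc c * \prod_(w <- s) normc (z - w).
Proof.
rewrite hornerZ normcM horner_prod normc_prod; congr (_ * _).
by apply: eq_bigr => w _; rewrite hornerXsubC.
Qed.

Lemma normc_horner_le f (d : nat) z : (size f <= d.+1)%N ->
  normc f.[z] <= (\sum_(i < d.+1) normc f`_i) * (1 + normc z) ^+ d.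
Proof.
move=> sz; rewrite (horner_coef_wide _ sz).
apply: (le_trans (normc_sum _ _)); rewrite mulr_suml.
apply: ler_sum => i _; rewrite normcM ler_wpM2l ?normc_ge0 // normcX.
have h : 1 <= 1 + normc z by rewrite lerDl normc_ge0.
apply: (@le_trans _ _ ((1 + normc z) ^+ i)).
  by rewrite lerXn2r ?nnegrE ?addr_ge0 ?normc_ge0 // lerDr.
by rewrite ler_weXn2l // -ltnS.
Qed.

(** The weight 1 + |z| makes the bound uniform on an unbounded half plane: near w the gap - Im w
    counts, far away the triangle inequality does. *)
Lemma half_plane_dist (w : C) : Im w < 0 -> exists2 k : R, 0 < k &
  forall z, 0 <= Im z -> k * (1 + normc z) <= normc (z - w).
Proof.
move=> w0; pose eta := - Im w; have eta0 : 0 < eta by rewrite oppr_gt0.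
have q0 : 0 < (1 + normc w) / eta + 1.
  by rewrite ltr_wpDl ?divr_ge0 ?addr_ge0 ?normc_ge0 // ltW.
exists ((1 + normc w) / eta + 1)^-1; first by rewrite invr_gt0.
move=> z z0; rewrite mulrC ler_pdivrMr //.
have h1 : eta <= normc (z - w).
  apply: le_trans (normc_ge_Im _); rewrite raddfB /=.
  by apply: le_trans (ler_norm _); rewrite /eta lerDr.
have h2 : normc z <= normc (z - w) + normc w.
  by rewrite -{1}(subrK w z) le_normcD.
have h3 : 1 + normc w <= normc (z - w) * ((1 + normc w) / eta).
  by rewrite mulrCA ler_peMr ?addr_ge0 ?normc_ge0 // ler_pdivlMr ?mul1r.
rewrite mulrDr mulr1; lra.
Qed.

Lemma half_plane_prod (s : seq C) : (forall w, w \in s -> Im w < 0) ->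
  exists2 k : R, 0 < k & forall z, 0 <= Im z ->
    k * (1 + normc z) ^+ size s <= \prod_(w <- s) normc (z - w).
Proof.
elim: s => [|w s IH] h.
  by exists 1 => // z _; rewrite big_nil expr0 mulr1.
have [v vs|k k0 hk] := IH; first by apply: h; rewrite inE vs orbT.
have [l l0 hl] := half_plane_dist (h w (mem_head w s)).
exists (l * k); first exact: mulr_gt0.
move=> z z0; rewrite big_cons exprS mulrACA ler_pM ?hl ?hk //.
  by rewrite mulr_ge0 ?addr_ge0 ?normc_ge0 // ltW.
by rewrite mulr_ge0 ?exprn_ge0 ?addr_ge0 ?normc_ge0 // ltW.
Qed.

Lemma half_plane_prod_ge (z : C) (s : seq C) :
  0 <= Im z -> (forall w, w \in s -> Im w <= 0) ->
  Im z ^+ size s <= \prod_(w <- s) normc (z - w).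
Proof.
move=> z0; elim: s => [|w s IH] h; first by rewrite big_nil.
rewrite big_cons exprS ler_pM ?exprn_ge0 //; last first.
  by apply: IH => v vs; apply: h; rewrite inE vs orbT.
apply: le_trans (normc_ge_Im _); apply: le_trans (ler_norm _).
by rewrite raddfB /= lerDl oppr_ge0 h ?mem_head.
Qed.

(* The set of r such that all roots of P r lie in Im z < 0 is open, |P r0| being
   bounded below by a multiple of (1 + |z|)^d on Im z >= 0, and closed, as
   |P r z0| >= |c| (Im z0)^d for z0 in the upper half plane and r in the set. *)
Lemma half_plane_roots (P : R -> {poly C}) (d : nat) (c : C) :
  c != 0 -> (forall r, (size (P r) <= d.+1)%N) -> (forall r, (P r)`_d = c) ->
  (forall i r0 (eps : R), 0 < eps ->
     \forall r \near r0, normc (P r - P r0)`_i < eps) ->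
  (forall r z, Im z = 0 -> ~~ root (P r) z) ->
  (forall z, root (P 0) z -> Im z < 0) ->
  forall r z, root (P r) z -> Im z < 0.
Proof.
move=> c0 sz lc Pcont Preal P0 r.
pose A := [set r | forall z, root (P r) z -> Im z < 0].
have diff_near r0 (eps : R) : 0 < eps -> \forall r \near r0,
    forall z, normc (P r - P r0).[z] <= eps * (1 + normc z) ^+ d.
  move=> eps0.
  have : \forall r \near r0, forall i : 'I_d.+1,
      normc (P r - P r0)`_i < eps / d.+1%:R.
    apply: (@filter_forall _ 'I_d.+1
      (fun i => [set r | normc (P r - P r0)`_i < eps / d.+1%:R]) (nbhs r0) _).
    by move=> i; apply: Pcont; rewrite divr_gt0 ?ltr0n.
  apply: filterS => r1 hr1 z.
  apply: le_trans (normc_horner_le z (_ : size _ <= d.+1)%N) _.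
    by rewrite (leq_trans (size_polyD _ _)) // size_polyN geq_max !sz.
  rewrite ler_wpM2r ?exprn_ge0 ?addr_ge0 ?normc_ge0 //.
  apply: le_trans (_ : \sum_(i < d.+1) (eps / d.+1%:R) <= _).
    by apply: ler_sum => i _; exact: ltW.
  by rewrite sumr_const card_ord -[_ *+ _]mulr_natr divfK ?pnatr_eq0.
have Aopen : open A.
  rewrite openE => r0 Ar0.
  have [s sE sroot] := poly_factor_size c0 (sz r0) (lc r0).
  have [k k0 hk] : exists2 k : R, 0 < k & forall z, 0 <= Im z ->
      k * (1 + normc z) ^+ d <= \prod_(w <- s) normc (z - w).
    have [w ws|k k0 hk] := @half_plane_prod s; first by apply: Ar0; rewrite sroot.
    by exists k => // z z0; have := hk z z0; rewrite size_tuple.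
  have ck0 : 0 < normc c * k / 2 by rewrite divr_gt0 ?mulr_gt0 ?normc_gt0.
  apply: filterS (diff_near r0 _ ck0) => r1 hr1 z rz.
  rewrite ltNge; apply/negP => z0.
  have p1 : 0 < (1 + normc z) ^+ d by rewrite exprn_gt0 // ltr_pwDl ?normc_ge0.
  have := hr1 z; rewrite hornerD hornerN (rootP rz) sub0r.
  have -> : normc (- (P r0).[z]) = normc (P r0).[z].
    by rewrite -mulN1r normcM complex.normcN normc1 mul1r.
  rewrite sE horner_roots_prod => h.
  have := ler_wpM2l (normc_ge0 c) (hk z z0).
  rewrite mulrA => /le_trans/(_ h).
  rewrite ler_pM2r // => h2.
  have : 0 < normc c * k by rewrite mulr_gt0 ?normc_gt0.
  lra.
have Acopen : open (~` A).
  rewrite openE => r0 /existsNP[z0 /not_implyP[rz0 /negP]].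
  rewrite -leNgt le_eqVlt => /orP[/eqP e|z00].
    by move: (Preal r0 z0 (esym e)); rewrite rz0.
  pose eps := normc c * Im z0 ^+ d / 2 / (1 + normc z0) ^+ d.
  have q0 : 0 < (1 + normc z0) ^+ d by rewrite exprn_gt0 // ltr_pwDl ?normc_ge0.
  have eps0 : 0 < eps.
    apply: divr_gt0 q0; apply: divr_gt0 => //.
    by apply: mulr_gt0; rewrite ?exprn_gt0 ?normc_gt0.
  apply: filterS (diff_near r0 _ eps0) => r1 /(_ z0).
  rewrite hornerD hornerN (rootP rz0) subr0 divfK ?gt_eqF // => h Ar1.
  have [s sE sroot] := poly_factor_size c0 (sz r1) (lc r1).
  have hle : Im z0 ^+ d <= \prod_(w <- s) normc (z0 - w).
    rewrite -{1}(size_tuple s); apply: half_plane_prod_ge (ltW z00) _ => w ws.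
    by apply/ltW/Ar1; rewrite sroot.
  move: h; rewrite sE horner_roots_prod.
  have := ler_wpM2l (normc_ge0 c) hle.
  have : 0 < normc c * Im z0 ^+ d by rewrite mulr_gt0 ?exprn_gt0 ?normc_gt0.
  lra.
have conn : connected [set: R].
  by apply/connected_intervalP => x y _ _ z _.
suff AT : A = setT by have : A r by rewrite AT.
apply: conn; first by exists 0.
- by exists A; rewrite ?setTI.
- by exists A; rewrite ?setTI // -[A]setCK; exact: open_closedC.
Qed.

End RootsInHalfPlane.

(** * Homogeneous polynomials restricted to a line *)

Section LinePolynomials.
Variables (R : comNzRingType) (m : nat).
Implicit Types (q : mpoly.mpoly m R) (d : nat).

Lemma mmap_rmorph (S T : comNzRingType) (f : {rmorphism R -> S})
    (g : {rmorphism S -> T}) (h : 'I_m -> S) q :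
  g (mpoly.mmap f h q) = mpoly.mmap (g \o f) (g \o h) q.
Proof.
rewrite /mpoly.mmap rmorph_sum; apply: eq_bigr => k _.
rewrite rmorphM /mpoly.mmap1 rmorph_prod; congr (_ * _).
by apply: eq_bigr => i _; rewrite rmorphXn.
Qed.

Lemma eq_mmap (S : comNzRingType) (f g : R -> S) (h k : 'I_m -> S) q :
  f =1 g -> h =1 k -> mpoly.mmap f h q = mpoly.mmap g k q.
Proof. by move=> /funext -> /funext ->. Qed.

Lemma mmap_homog (S : comNzRingType) (f : R -> S) (h : 'I_m -> S) (z : S) q d :
  q \is mpoly.ishomog1 d (@mpoly.mdeg m) ->
  mpoly.mmap f (fun i => z * h i) q = z ^+ d * mpoly.mmap f h q.
Proof.
move=> /mpoly.dhomogP hq; rewrite /mpoly.mmap mulr_sumr.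
rewrite !big_seq; apply: eq_bigr => k kq.
rewrite mulrCA; congr (_ * _); rewrite /mpoly.mmap1.
have -> : d = mpoly.mdeg k by rewrite -(hq k kq).
rewrite mpoly.mdegE expr_sum -big_split /=.
by apply: eq_bigr => i _; rewrite exprMn.
Qed.

Lemma size_coef_mul (S : comNzRingType) (P Q : {poly S}) (k l : nat) :
  (size P <= k.+1)%N -> (size Q <= l.+1)%N ->
  (size (P * Q)%R <= (k + l).+1)%N /\ (P * Q)`_(k + l) = P`_k * Q`_l.
Proof.
move=> sP sQ; split.
  apply: (leq_trans (size_mul_leq P Q)); rewrite -subn1 leq_subLR add1n.
  by rewrite -addSn -addnS leq_add.
have hk : (k < (k + l).+1)%N by rewrite ltnS leq_addr.
rewrite coefM (bigD1 (Ordinal hk)) //= addKn big1 ?addr0 // => i /eqP neq.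
have [lt|le] := ltnP i k; last first.
  have lt : (k < i)%N.
    rewrite ltn_neqAle le andbT; apply/eqP => e; apply: neq.
    exact/val_inj/esym.
  by rewrite (nth_default _ (leq_trans sP lt)) mul0r.
by rewrite [Q`__]nth_default ?mulr0 // (leq_trans sQ) // ltn_subRL ltn_add2r.
Qed.

Lemma size_coef_exp (S : comNzRingType) (P : {poly S}) (k : nat) :
  (size P <= 2)%N -> (size (P ^+ k)%R <= k.+1)%N /\ (P ^+ k)`_k = P`_1 ^+ k.
Proof.
move=> sP; elim: k => [|k [IH1 IH2]].
  by rewrite expr0 size_poly1 coef1 expr0.
by have [h1 h2] := size_coef_mul sP IH1; rewrite !exprS -IH2 -h2 -add1n.
Qed.

(** The top coefficient sees only the direction w, not the base point u; this keeps degree and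
    leading coefficient fixed when the base point moves, as [half_plane_roots] requires. *)
Lemma size_coef_mmap_line (S : comNzRingType) (f : {rmorphism R -> S})
    (u w : 'I_m -> S) q d : q \is mpoly.ishomog1 d (@mpoly.mdeg m) ->
  let P := mpoly.mmap (polyC \o f) (fun i => (u i)%:P + (w i)%:P * 'X) q in
  (size P <= d.+1)%N /\ P`_d = mpoly.mmap f w q.
Proof.
move=> /mpoly.dhomogP hq P; rewrite {}/P /mpoly.mmap !big_seq.
pose T (P : {poly S}) (c : S) := (size P <= d.+1)%N /\ P`_d = c.
apply: (big_ind2 T); first by rewrite /T size_poly0 coef0.
  move=> P1 c1 P2 c2 [s1 e1] [s2 e2]; split; last by rewrite coefD e1 e2.
  by rewrite (leq_trans (size_polyD _ _)) // geq_max s1 s2.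
move=> k kq /=; have : mpoly.mdeg k = d by exact: hq.
rewrite mpoly.mdegE /mpoly.mmap1 {}/T => <-.
suff [h1 h2] : (size (\prod_(i < m) ((u i)%:P + (w i)%:P * 'X) ^+ k i)%R <=
   (\sum_(i < m) k i).+1)%N /\ (\prod_(i < m) ((u i)%:P + (w i)%:P * 'X) ^+ k i)
      `_(\sum_(i < m) k i) = \prod_(i < m) w i ^+ k i.
  by rewrite coefCM h2; split=> //; rewrite mul_polyC (leq_trans (size_scale_leq _ _)).
apply: (big_ind3 (fun (P : {poly S}) (a : nat) (c : S) =>
   (size P <= a.+1)%N /\ P`_a = c)); first by rewrite size_poly1 coef1.
  move=> P1 a1 c1 P2 a2 c2 [s1 e1] [s2 e2].
  by have [h1 h2] := size_coef_mul s1 s2; rewrite h2 e1 e2.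
move=> i _; have s2 : (size ((u i)%:P + (w i)%:P * 'X)%R <= 2)%N.
  by rewrite addrC size_MXaddC; case: ifP => // _; rewrite ltnS size_polyC leq_b1.
have [h1 h2] := size_coef_exp (k i) s2; rewrite h2; split=> //.
by rewrite coefD coefC coefMX coefC add0r.
Qed.

End LinePolynomials.

(** * Garding's theorem *)

Section Gaarding.
Variables (R : realType) (m : nat).
Local Notation C := (complex.complex R).
Local Notation ri := (complex.real_complex R).
Local Notation Ci := (complex.Complex 0 1 : C).
Local Notation normc := (@complex.ComplexField.Normc.normc R).
Local Notation Im := complex.Im.
Implicit Types (q : mpoly.mpoly m R) (u w : 'rV[C]_m) (x e : 'rV[R]_m) (z : C).

Definition cvec x : 'rV[C]_m := map_mx ri x.

Definition ceval q w : C := mpoly.mmap ri (w 0) q.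

Lemma cvecD x y : cvec (x + y) = cvec x + cvec y.
Proof. exact: map_mxD. Qed.

Lemma cvecZ (r : R) x : cvec (r *: x) = ri r *: cvec x.
Proof. exact: map_mxZ. Qed.

Lemma cvecDZ (r : R) x y : cvec (x + r *: y) = cvec x + ri r *: cvec y.
Proof. by rewrite cvecD cvecZ. Qed.

Lemma ceval_cvec q x : ceval q (cvec x) = ri (peval q x).
Proof.
rewrite /ceval /peval /mpoly.meval mmap_rmorph.
by apply: eq_mmap => // i; rewrite mxE.
Qed.

Lemma ceval_homog q d z w : q \is mpoly.ishomog1 d (@mpoly.mdeg m) ->
  ceval q (z *: w) = z ^+ d * ceval q w.
Proof.
move=> hq; rewrite /ceval -mmap_homog //.
by apply: eq_mmap => // i; rewrite mxE.
Qed.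

Definition line_poly q u w : {poly C} :=
  mpoly.mmap (polyC \o ri) (fun i => (u 0 i)%:P + (w 0 i)%:P * 'X) q.

Lemma horner_line_poly q u w z : (line_poly q u w).[z] = ceval q (u + z *: w).
Proof.
rewrite -horner_evalE /line_poly mmap_rmorph /ceval.
apply: eq_mmap => [r|i] /=; rewrite horner_evalE ?hornerE //.
by rewrite !mxE mulrC.
Qed.

Lemma horner_lipschitz_near (f : {poly C}) (r0 : R) : exists2 K : R, 0 < K &
  forall r, `|r - r0| <= 1 -> normc (f.[ri r] - f.[ri r0]) <= K * `|r - r0|.
Proof.
elim/poly_ind: f => [|f c [K K0 hK]].
  by exists 1 => // r _; rewrite !horner0 subrr normc0 mulr_ge0.
exists (K * (`|r0| + 1) + normc f.[ri r0]) => [|r hr].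
  by rewrite ltr_pwDl ?normc_ge0 // mulr_gt0 // ltr_wpDl.
rewrite !hornerMXaddC opprD addrACA subrr addr0.
have -> : f.[ri r] * ri r - f.[ri r0] * ri r0 =
    (f.[ri r] - f.[ri r0]) * ri r + f.[ri r0] * ri (r - r0).
  by rewrite rmorphB /=; ring.
apply: le_trans (le_normcD _ _) _; rewrite !normcM !normc_real mulrDl.
apply: lerD => //; rewrite mulrAC ler_pM ?normc_ge0 ?hK //.
by rewrite -{1}(subrK r0 r) (le_trans (ler_normD _ _)) // addrC lerD2l.
Qed.

Lemma horner_near (f : {poly C}) (r0 eps : R) : 0 < eps ->
  \forall r \near r0, normc (f.[ri r] - f.[ri r0]) < eps.
Proof.
move=> eps0; have [K K0 hK] := horner_lipschitz_near f r0.
apply/nbhs_ballP; exists (Num.min 1 (eps / K)) => /=.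
  by rewrite lt_min ltr01 divr_gt0.
move=> r; rewrite /ball /= distrC lt_min => /andP[h1 h2].
apply: le_lt_trans (hK r (ltW h1)) _.
by rewrite mulrC -ltr_pdivlMr.
Qed.

(** A path quadratic in r covers both deformations used below: r x, and i r^2 x. In the second, the
    square keeps the imaginary multiple nonnegative although r ranges over the whole real line. *)
Lemma line_family_roots q d u0 u1 u2 w :
  q \is mpoly.ishomog1 d (@mpoly.mdeg m) -> ceval q w != 0 ->
  let u r := u0 + ri r *: u1 + ri r ^+ 2 *: u2 in
  (forall r t : R, ceval q (u r + ri t *: w) != 0) ->
  (forall z, ceval q (u0 + z *: w) = 0 -> Im z < 0) ->
  forall (r : R) z, ceval q (u r + z *: w) = 0 -> Im z < 0.
Proof.
move=> hq w0 u hreal h0 r z hz.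
(* [PP] has r as a second indeterminate: the coefficients of [P r] are values of polynomials at r,
   hence continuous in r. *)
pose U i : {poly C} := (u0 0 i)%:P + (u1 0 i)%:P * 'X + (u2 0 i)%:P * 'X^2.
pose PP : {poly {poly C}} := mpoly.mmap (polyC \o (polyC \o ri))
  (fun i => (U i)%:P + ((w 0 i)%:P)%:P * 'X) q.
pose P (r : R) := line_poly q (u r) w.
have PE s : P s = map_poly (horner_eval (ri s)) PP.
  rewrite /PP mmap_rmorph /P /line_poly; apply: eq_mmap => [y|i] /=.
    by rewrite map_polyC /= horner_evalE hornerC.
  rewrite rmorphD rmorphM /= !map_polyC map_polyX /= !horner_evalE !hornerE.
  rewrite /u !mxE; congr (_%:P + _); congr (_ + _ + _); first exact: mulrC.
  by rewrite mulrC expr2 mulrA.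
have [sP lP] : (forall s, (size (P s) <= d.+1)%N) /\ (forall s, (P s)`_d = ceval q w).
  by split=> s; have [] := size_coef_mmap_line ri (u s 0) (w 0) hq.
apply: (@half_plane_roots R P d (ceval q w) w0 sP lP _ _ _ r) => //.
- move=> i r0 eps eps0; apply: filterS (horner_near PP`_i r0 eps0) => s.
  by rewrite coefB !PE !coef_map /= !horner_evalE.
- move=> s [a b] /= ->; rewrite rootE horner_line_poly; exact: hreal.
- move=> y /rootP; rewrite horner_line_poly /u expr0n /= !scale0r !addr0.
  exact: h0.
- by apply/rootP; rewrite horner_line_poly.
Qed.

Definition hyperbolic q e :=
  peval q e != 0 /\
  forall x z, ceval q (cvec x - z *: cvec e) = 0 -> Im z = 0.

(** For q hyperbolic along e this says that all eigenvalues of x are positive, that is, x lies in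
    the open cone of q around e. *)
Definition positive_dir q e x := forall s : R, 0 <= s -> peval q (x + s *: e) != 0.

Variables (q : mpoly.mpoly m R) (d : nat) (e : 'rV[R]_m).
Hypotheses (hq : q \is mpoly.ishomog1 d (@mpoly.mdeg m)) (hyp : hyperbolic q e).

Lemma ri_eq0 (r : R) : (ri r == 0) = (r == 0).
Proof. by rewrite complex.eq_complex /= eqxx andbT. Qed.

Lemma hyperbolic_nonreal x z : Im z != 0 -> ceval q (cvec x + z *: cvec e) != 0.
Proof.
move=> z0; apply/eqP => h; move/eqP: z0; apply.
have := hyp.2 x (- z); rewrite scaleNr opprK raddfN /= => /(_ h) /eqP.
by rewrite oppr_eq0 => /eqP.
Qed.

(* Garding's argument: the roots of t |-> q (i al e + r x + t y) are in Im t < 0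
   for r = 0, and cannot cross the real axis as r varies, q being hyperbolic
   along e. *)
Lemma positive_dir_root x z (al : R) : positive_dir q e x -> 0 < al ->
  ceval q ((Ci * ri al) *: cvec e + z *: cvec x) = 0 -> Im z < 0.
Proof.
move=> hx al0 hz.
have z0 : z != 0.
  apply/eqP => z0; move/eqP: hz; rewrite z0 scale0r addr0 (ceval_homog _ _ hq).
  rewrite ceval_cvec mulf_eq0 ri_eq0 (negPf hyp.1) orbF expf_eq0.
  rewrite mulf_eq0 ri_eq0 (gt_eqF al0) complex.eq_complex /= oner_eq0 andbF.
  by rewrite andbF.
have : ceval q (cvec x + (Ci * ri al / z) *: cvec e) = 0.
  have E : (Ci * ri al) *: cvec e + z *: cvec x =
      z *: (cvec x + (Ci * ri al / z) *: cvec e).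
    by rewrite scalerDr scalerA [z * _]mulrC divfK // addrC.
  have /eqP := hz; rewrite E (ceval_homog _ _ hq) mulf_eq0 expf_eq0 (negPf z0).
  by rewrite andbF => /eqP.
rewrite ltNge => hs; apply/negP => imz.
have ims : Im (Ci * ri al / z) = 0.
  by apply/eqP/negPn/negP => /(@hyperbolic_nonreal x); rewrite hs eqxx.
set s := Ci * ri al / z in hs ims.
have sE : s = ri (complex.Re s) by case: s ims {hs} => a b /= ->.
have szE : ri (complex.Re s) * z = Ci * ri al by rewrite -sE divfK.
have sb : complex.Re s * Im z = al.
  have := congr1 (fun w : C => Im w) szE.
  by case: (z) => a b /=; rewrite !mul0r mul1r !(addr0, add0r).
rewrite sE -cvecDZ ceval_cvec in hs; move/eqP: hs; rewrite ri_eq0 => hs.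
have [s0|s0] := leP 0 (complex.Re s); first by have := hx _ s0; rewrite hs.
by move: al0; rewrite -sb ltNge nmulr_rle0 // imz.
Qed.

Lemma hyperbolic_stable x y (al r : R) z : positive_dir q e y -> 0 < al ->
  ceval q ((Ci * ri al) *: cvec e + ri r *: cvec x + z *: cvec y) = 0 -> Im z < 0.
Proof.
move=> hy al0 hz.
apply: (@line_family_roots q d ((Ci * ri al) *: cvec e) (cvec x) 0 (cvec y)
          hq _ _ _ r z); last by rewrite scaler0 addr0.
- by rewrite ceval_cvec ri_eq0; have := hy 0 (lexx _); rewrite scale0r addr0.
- move=> {r hz} r t; rewrite scaler0 addr0 -addrA addrC -!cvecZ -cvecD.
  by apply: hyperbolic_nonreal; rewrite /= mul0r mul1r add0r gt_eqF.
- by move=> w; apply: positive_dir_root.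
Qed.

Lemma positive_dir_stable x y (al be : R) z : positive_dir q e x ->
  positive_dir q e y -> 0 < al -> 0 <= be ->
  ceval q ((Ci * ri al) *: cvec e + (Ci * ri be) *: cvec x + z *: cvec y) = 0 ->
  Im z < 0.
Proof.
move=> hx hy al0 be0 hz.
apply: (@line_family_roots q d ((Ci * ri al) *: cvec e) 0 (Ci *: cvec x) (cvec y)
          hq _ _ _ (Num.sqrt be) z).
- by rewrite ceval_cvec ri_eq0; have := hy 0 (lexx _); rewrite scale0r addr0.
(* The roles of x and y are exchanged: a real root t would make i r^2, whose imaginary part is
   nonnegative, a root in direction x, against [hyperbolic_stable]. *)
- move=> r t; rewrite scaler0 addr0 addrAC scalerA; apply/eqP => h.
  have := hyperbolic_stable hx al0 h.
  by rewrite -rmorphXn /= !(mul0r, mulr0, mulr1, addr0, add0r) ltNge sqr_ge0.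
- by move=> w; apply: positive_dir_root.
- have E : ri (Num.sqrt be) ^+ 2 * Ci = Ci * ri be.
    by rewrite -rmorphXn sqr_sqrtr // mulrC.
  by rewrite scaler0 addr0 scalerA E.
Qed.

(** Convexity of the cone: multiplication by i changes q only by the factor i^d, and turns a zero
    into a root i ga that [positive_dir_stable] forbids. *)
Lemma positive_dir_add x y (al be ga : R) : positive_dir q e x ->
  positive_dir q e y -> 0 < al -> 0 <= be -> 0 <= ga ->
  peval q (al *: e + be *: x + ga *: y) != 0.
Proof.
move=> hx hy al0 be0 ga0; apply/eqP => h.
have : ceval q ((Ci * ri al) *: cvec e + (Ci * ri be) *: cvec x +
    (Ci * ri ga) *: cvec y) = 0.
  rewrite -!scalerA -!scalerDr (ceval_homog _ _ hq) -!cvecZ -!cvecD ceval_cvec h.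
  exact: mulr0.
move/(positive_dir_stable hx hy al0 be0) => /=.
by rewrite mul0r mul1r add0r ltNge ga0.
Qed.

Lemma positive_dir_open x : positive_dir q e x ->
  exists2 a : R, 0 < a & positive_dir q e (x - a *: e).
Proof.
move=> hx; pose f := line_poly q (cvec x) (cvec e).
have fE r : f.[ri r] = ri (peval q (x + r *: e)).
  by rewrite horner_line_poly -cvecDZ ceval_cvec.
have f0 : 0 < normc f.[ri 0] by rewrite fE normc_gt0 ri_eq0 hx.
have /nbhs_ballP[b /= b0 hb] := horner_near f 0 f0.
exists (b / 2); first by rewrite divr_gt0.
move=> s s0; rewrite -addrA -scaleNr -scalerDl.
(* Beyond s = b / 2 the shifted ray runs inside the old one; the short initial piece is covered by
   continuity at x. *)
have [h|h] := leP 0 (- (b / 2) + s); first exact: hx.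
apply/eqP => e0; suff /hb : ball 0 b (- (b / 2) + s).
  rewrite /= fE e0 rmorph0 sub0r -mulN1r normcM complex.normcN normc1 mul1r.
  by rewrite ltxx.
by rewrite /ball /= sub0r normrN ltr0_norm //; lra.
Qed.

(** Garding's change of direction. Divided by - Im z, the vector y - z x becomes i a e + Y + i (x -
    a e) with Y real, where [hyperbolic_stable] forbids a zero; the margin a comes from openness of
    the cone. *)
Lemma hyperbolic_dir x : positive_dir q e x -> hyperbolic q x.
Proof.
move=> hx; split.
  by have := hx 0 (lexx _); rewrite scale0r addr0.
move=> y z hz; apply/eqP/negPn/negP => v0.
have [a a0 ha] := positive_dir_open hx.
pose v := Im z; pose Y := - v^-1 *: (y - complex.Re z *: x).
suff E : cvec y - z *: cvec x = ri (- v) *: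
    ((Ci * ri a) *: cvec e + ri 1 *: cvec Y + Ci *: cvec (x - a *: e)).
  move: hz; rewrite E (ceval_homog _ _ hq) => /eqP.
  rewrite mulf_eq0 expf_eq0 ri_eq0 oppr_eq0 (negPf v0) andbF /= => /eqP.
  by move/(hyperbolic_stable ha a0) => /=; rewrite ltr10.
have v1 : v != 0 by [].
apply/rowP => i; rewrite !mxE.
by case: (z) @v v1 @Y => b c /= c0; apply/eqP; rewrite complex.eq_complex /=;
  apply/andP; split; apply/eqP; field.
Qed.

End Gaarding.

(** * Symmetric functions of the eigenvalues *)

Section PolynomialIdentity.
Variable F : numDomainType.

Lemma poly_horner_eq0 (f : {poly F}) : (forall z, z != 0 -> f.[z] = 0) -> f = 0.
Proof.
move=> h; apply: contraTeq isT => f0.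
pose s := [seq (i.+1)%:R : F | i <- iota 0 (size f)].
have us : uniq s.
  rewrite map_inj_uniq ?iota_uniq // => i j /eqP.
  by rewrite eqr_nat eqSS => /eqP.
have /max_poly_roots : all (root f) s.
  by apply/allP => _ /mapP[i _ ->]; apply/rootP/h; rewrite pnatr_eq0.
by move=> /(_ f0 us); rewrite size_map size_iota ltnn.
Qed.

Lemma poly_horner_inj (f g : {poly F}) : (forall z, z != 0 -> f.[z] = g.[z]) -> f = g.
Proof.
move=> h; apply/eqP; rewrite -subr_eq0; apply/eqP/poly_horner_eq0 => z z0.
by rewrite hornerD hornerN h ?subrr.
Qed.

End PolynomialIdentity.

Section SymmetricPolynomials.
Variables (R : comNzRingType) (n : nat).
Local Notation X i := (mpoly.mpolyX R (mpoly.mnm1 i) : mpoly.mpoly n R).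

Lemma msym_X (s : 'S_n) i : mpoly.msym s (X i) = X (s i).
Proof. by rewrite /mpoly.msym mpoly.mmapX mpoly.mmap1U. Qed.

(** A weighted sum of eigenvalues depends on their order. The product over all orders is symmetric,
    and being a product of linear forms it still displays its own eigenvalues. *)
Definition weighted_orbit_prod (w : 'I_n -> R) : mpoly.mpoly n R :=
  \prod_(s : 'S_n) \sum_(j < n) w j *: X (s j).

Lemma weighted_orbit_prod_sym w : weighted_orbit_prod w \is @mpoly.symmetric n R.
Proof.
apply/mpoly.issymP => t; rewrite /weighted_orbit_prod rmorph_prod /=.
rewrite [RHS](reindex_inj (mulIg t)) /=; apply: eq_bigr => s _.
rewrite raddf_sum; apply: eq_bigr => j _ /=.
by rewrite mpoly.msymZ msym_X permM.
Qed.

Lemma mmap_weighted_orbit_prod (S : comNzRingType) (f : {rmorphism R -> S}) h w :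
  mpoly.mmap f h (weighted_orbit_prod w) =
  \prod_(s : 'S_n) \sum_(j < n) f (w j) * h (s j).
Proof.
rewrite /weighted_orbit_prod rmorph_prod; apply: eq_bigr => s _; rewrite raddf_sum.
by apply: eq_bigr => j _ /=; rewrite mpoly.mmapZ mpoly.mmapX mpoly.mmap1U.
Qed.

Definition poly_sum (g : {poly R}) : mpoly.mpoly n R :=
  \sum_(j < n) \sum_(k < size g) g`_k *: X j ^+ k.

Lemma poly_sum_sym g : poly_sum g \is @mpoly.symmetric n R.
Proof.
apply/mpoly.issymP => t; rewrite /poly_sum raddf_sum.
rewrite [RHS](reindex_inj (@perm_inj _ t)) /=; apply: eq_bigr => j _.
rewrite raddf_sum; apply: eq_bigr => k _ /=.
by rewrite mpoly.msymZ rmorphXn /= msym_X.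
Qed.

Lemma mmap_poly_sum (S : comNzRingType) (f : {rmorphism R -> S}) h g :
  mpoly.mmap f h (poly_sum g) = \sum_(j < n) (map_poly f g).[h j].
Proof.
rewrite /poly_sum raddf_sum; apply: eq_bigr => j _; rewrite raddf_sum.
rewrite (horner_coef_wide _ (size_poly _ _)); apply: eq_bigr => k _ /=.
by rewrite mpoly.mmapZ rmorphXn /= mpoly.mmapX mpoly.mmap1U coef_map.
Qed.

Lemma mmap_mesym (S : comNzRingType) (f : {rmorphism R -> S}) (h : 'I_n -> S) k :
  mpoly.mmap f h (mpoly.mesym n R k) = mpoly.meval h (mpoly.mesym n S k).
Proof.
rewrite /mpoly.mesym !raddf_sum; apply: eq_bigr => A _.
rewrite /= !rmorph_prod; apply: eq_bigr => i _ /=.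
by rewrite mpoly.mmapX mpoly.mmap1U mpoly.mevalXU.
Qed.

Lemma mmap_comp_mpoly (m : nat) (S : comNzRingType) (f : {rmorphism R -> S})
    (h : 'I_m -> S) (lq : n.-tuple (mpoly.mpoly m R)) t :
  mpoly.mmap f h (mpoly.comp_mpoly lq t) =
  mpoly.mmap f (fun i => mpoly.mmap f h (tnth lq i)) t.
Proof.
rewrite /mpoly.comp_mpoly mmap_rmorph; apply: eq_mmap => // c /=.
exact: mpoly.mmapC.
Qed.

End SymmetricPolynomials.

Section Spectrum.
Variables (R : realType) (m n : nat) (p : mpoly.mpoly m R) (e : 'rV[R]_m).
Local Notation C := (complex.complex R).
Local Notation ri := (complex.real_complex R).
Hypothesis hp : p \is mpoly.ishomog1 n (@mpoly.mdeg m).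
Hypothesis pe0 : peval p e != 0.
Implicit Types (w : 'rV[C]_m) (x : 'rV[R]_m).

(** The roots are listed with multiplicity. Complex w are allowed because hyperbolicity of a
    polynomial derived from p involves its values at v - z e with z nonreal. *)
Definition spectrum w (c : n.-tuple C) := forall T : C,
  ceval p (w - T *: cvec e) = ri (peval p e) * \prod_(i < n) (tnth c i - T).

Lemma line_poly_spectrum w (c : n.-tuple C) : spectrum w c <->
  line_poly p w (- cvec e) =
    (ri (peval p e) * (-1) ^+ n) *: \prod_(z <- c) ('X - z%:P).
Proof.
have E T : (ri (peval p e) * (-1) ^+ n) * (\prod_(z <- c) ('X - z%:P)).[T] =
    ri (peval p e) * \prod_(i < n) (tnth c i - T).
  rewrite -mulrA; congr (_ * _); rewrite horner_prod big_tuple.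
  rewrite -[n in _ ^+ n]card_ord -prodr_const -big_split /=.
  by apply: eq_bigr => i _; rewrite hornerXsubC mulN1r opprB.
split=> [h|h T].
  apply: poly_horner_inj => T _; rewrite horner_line_poly hornerZ E -h.
  by rewrite scalerN.
by rewrite -E -hornerZ -h horner_line_poly scalerN.
Qed.

Lemma spectrum_exists w : exists c, spectrum w c.
Proof.
have [sz lc] := size_coef_mmap_line ri (w 0) ((- cvec e) 0) hp.
have lcE : (line_poly p w (- cvec e))`_n = ri (peval p e) * (-1) ^+ n.
  by rewrite [LHS]lc -/(ceval p _) -scaleN1r (ceval_homog _ _ hp) ceval_cvec mulrC.
have lc0 : ri (peval p e) * (-1) ^+ n != 0.
  by rewrite mulf_eq0 ri_eq0 (negPf pe0) signr_eq0.
have [c cE _] := poly_factor_size lc0 sz lcE.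
by exists c; apply/line_poly_spectrum.
Qed.

Lemma spectrum_scale w c z : spectrum w c ->
  spectrum (z *: w) [tuple z * tnth c i | i < n].
Proof.
move=> hc T; have [->|z0] := eqVneq z 0.
  rewrite scale0r sub0r -scaleNr (ceval_homog _ _ hp) ceval_cvec mulrC.
  congr (_ * _); rewrite -[n in _ ^+ n]card_ord -prodr_const.
  by apply: eq_bigr => i _; rewrite tnth_mktuple mul0r sub0r.
have -> : z *: w - T *: cvec e = z *: (w - (T / z) *: cvec e).
  by rewrite scalerBr scalerA [z * _]mulrC divfK.
rewrite (ceval_homog _ _ hp) hc mulrCA; congr (_ * _).
rewrite -[n in _ ^+ n]card_ord -prodr_const -big_split /=.
apply: eq_bigr => i _; rewrite tnth_mktuple mulrBr; congr (_ - _).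
by rewrite mulrC divfK.
Qed.

Lemma spectrum_shift w c z : spectrum w c ->
  spectrum (w + z *: cvec e) [tuple tnth c i + z | i < n].
Proof.
move=> hc T; rewrite -addrA -scalerBl -[z - T]opprB scaleNr hc; congr (_ * _).
by apply: eq_bigr => i _; rewrite tnth_mktuple opprB addrA.
Qed.

(** The characteristic polynomial p (x - T e) with the coordinates of x as indeterminates, so that
    its coefficients are polynomials in x. *)
Definition pencil_poly : {poly mpoly.mpoly m R} :=
  mpoly.mmap (polyC \o @mpoly.mpolyC m R)
    (fun i => (mpoly.mpolyX R (mpoly.mnm1 i))%:P +
              (- mpoly.mpolyC m (e 0 i))%:P * 'X) p.

Lemma ceval_pencil_poly w i : ceval pencil_poly`_i w = (line_poly p w (- cvec e))`_i.
Proof.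
rewrite /ceval -[LHS]coef_map; apply: (congr1 (fun q : {poly C} => q`_i)).
rewrite /pencil_poly /line_poly mmap_rmorph.
apply: eq_mmap => [r|j] /=.
  by rewrite map_polyC /= mpoly.mmapC.
rewrite rmorphD rmorphM /= !map_polyC map_polyX /=.
by rewrite mpoly.mmapX mpoly.mmap1U mpoly.mmapN mpoly.mmapC !mxE.
Qed.

(** By Vieta's formulas this is the k-th elementary symmetric function of the eigenvalues: one sign
    (-1)^n comes from the leading coefficient p(e) (-1)^n, the other, (-1)^k, from Vieta. *)
Definition elem_sym (k : nat) : mpoly.mpoly m R :=
  ((-1) ^+ (n + k) / peval p e) *: pencil_poly`_(n - k).

Lemma ceval_elem_sym w c k : (k <= n)%N -> spectrum w c ->
  ceval (elem_sym k) w = mpoly.meval (tnth c) (mpoly.mesym n C k).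
Proof.
move=> kn /line_poly_spectrum h.
rewrite /ceval mpoly.mmapZ -/(ceval _ _) ceval_pencil_poly h coefZ.
have := mpoly.mroots_coeff c (Ordinal (kn : (k < n.+1)%N)) => /= ->.
rewrite rmorphM fmorphV rmorphXn rmorphN1; move: (mpoly.meval _ _) => y.
have E : (-1) ^+ (n + k) * ((-1) ^+ n * (-1) ^+ k) = 1 :> C.
  by rewrite -exprD -expr2 sqrr_sign.
rewrite -!mulrA mulKf ?ri_eq0 // [X in _ * X]mulrA mulrA E.
exact: mul1r.
Qed.

(** The fundamental theorem of symmetric polynomials reduces f to the elementary ones, which are the
    polynomials [elem_sym] of x. *)
Lemma symmetric_spectrum (f : mpoly.mpoly n R) : f \is @mpoly.symmetric n R ->
  exists g : mpoly.mpoly m R, forall w c, spectrum w c ->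
    ceval g w = mpoly.mmap ri (tnth c) f.
Proof.
move=> /mpoly.sym_fundamental[t [tE _]].
exists (mpoly.comp_mpoly [tuple elem_sym i.+1 | i < n] t) => w c hc.
rewrite -tE /ceval !mmap_comp_mpoly; apply: eq_mmap => // i.
by rewrite !tnth_mktuple -/(ceval _ _) (ceval_elem_sym (ltn_ord i) hc) mmap_mesym.
Qed.

(** Garding's theorem is stated for homogeneous polynomials, so the component of degree d of g is
    taken. It has the same values as g, by comparing coefficients in g (z w) = z^d g w, an identity
    between polynomials in z. *)
Lemma homog_symmetric_spectrum (f : mpoly.mpoly n R) d :
  f \is @mpoly.symmetric n R ->
  (forall (h : 'I_n -> C) z,
     mpoly.mmap ri (fun i => z * h i) f = z ^+ d * mpoly.mmap ri h f) ->
  exists2 g : mpoly.mpoly m R, g \is mpoly.ishomog1 d (@mpoly.mdeg m) &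
    forall w c, spectrum w c -> ceval g w = mpoly.mmap ri (tnth c) f.
Proof.
move=> fsym fhom; have [g hg] := symmetric_spectrum fsym.
exists (mpoly.pihomog (@mpoly.mdeg m) d g); first exact: mpoly.pihomogP.
move=> w c hc; rewrite -(hg _ _ hc).
pose k := mpoly.mmeasure (@mpoly.mdeg m) g.
have gE : g = \sum_(i < k) mpoly.pihomog (@mpoly.mdeg m) i g.
  by rewrite {1}(@mpoly.pihomog_partitionE _ _ (@mpoly.mdeg m) k g (leqnn _)).
pose P : {poly C} := \poly_(i < k) ceval (mpoly.pihomog (@mpoly.mdeg m) i g) w.
have PE : P = ceval g w *: 'X^d.
  apply: poly_horner_inj => z _; rewrite horner_poly hornerZ hornerXn.
  transitivity (ceval g (z *: w)).
    rewrite {2}gE [RHS]raddf_sum; apply: eq_bigr => i _ /=.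
    by rewrite -[RHS]/(ceval _ _) (ceval_homog _ _ (mpoly.pihomogP _ _ _)) mulrC.
  rewrite (hg _ _ (spectrum_scale z hc)) (hg _ _ hc) mulrC -fhom.
  by apply: eq_mmap => // i; rewrite tnth_mktuple.
have := congr1 (fun q : {poly C} => q`_d) PE.
rewrite /P coef_poly coefZ coefXn eqxx mulr1 => <-.
case: ltnP => // le; rewrite [mpoly.pihomog _ _ _](_ : _ = 0).
  by rewrite /ceval raddf0.
rewrite mpoly.pihomogE big_seq_cond big1 // => i /andP[ig /eqP di].
by have := mpoly.mmeasure_mnm_lt (@mpoly.mdeg m) ig; rewrite di ltnNge le.
Qed.

End Spectrum.

Section RealSpectrum.
Variables (R : realType) (m n : nat) (p : mpoly.mpoly m R) (e : 'rV[R]_m).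
Local Notation C := (complex.complex R).
Local Notation ri := (complex.real_complex R).
Hypothesis hp : p \is mpoly.ishomog1 n (@mpoly.mdeg m).
Hypothesis hyp : hyperbolic p e.
Implicit Types (x y : 'rV[R]_m) (l : n.-tuple R).

Definition real_spectrum x l :=
  spectrum p e (cvec x) [tuple ri (tnth l i) | i < n].

Lemma real_spectrumE x l : real_spectrum x l -> forall T : R,
  peval p (x - T *: e) = peval p e * \prod_(i < n) (tnth l i - T).
Proof.
move=> h T; apply: (@complex.complexI R); rewrite -ceval_cvec -scaleNr cvecDZ.
rewrite rmorphN scaleNr h rmorphM rmorph_prod; congr (_ * _).
by apply: eq_bigr => i _; rewrite tnth_mktuple rmorphB.
Qed.

Lemma real_spectrum_exists x : exists l, real_spectrum x l.
Proof.
have [c hc] := spectrum_exists hp hyp.1 (cvec x).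
exists [tuple complex.Re (tnth c i) | i < n].
rewrite /real_spectrum.
suff -> : [tuple ri (tnth [tuple complex.Re (tnth c i) | i < n] i) | i < n] = c by [].
apply: eq_from_tnth => i; rewrite !tnth_mktuple.
have : ceval p (cvec x - tnth c i *: cvec e) = 0.
  by rewrite hc (bigD1 i) //= subrr mul0r mulr0.
by move=> /hyp.2; case: (tnth c i) => a b /= ->.
Qed.

Lemma horner_eig_poly x T : (eig_poly p e x).[T] = peval p (x - T *: e).
Proof.
rewrite -horner_evalE /eig_poly mmap_rmorph; apply: eq_mmap => [r|i] /=.
  by rewrite horner_evalE hornerC.
by rewrite horner_evalE !hornerE !mxE [T * _]mulrC.
Qed.

Lemma eig_poly_factor x l : real_spectrum x l ->
  eig_poly p e x = (peval p e * (-1) ^+ n) *: \prod_(r <- l) ('X - r%:P).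
Proof.
move=> h; apply: poly_horner_inj => T _.
rewrite horner_eig_poly (real_spectrumE h) hornerZ -mulrA; congr (_ * _).
rewrite horner_prod big_tuple -[n in _ ^+ n]card_ord -prodr_const -big_split /=.
by apply: eq_bigr => i _; rewrite hornerXsubC mulN1r opprB.
Qed.

Lemma eigenvalues_perm x l : real_spectrum x l -> perm_eq (eigenvalues p e x) l.
Proof.
move=> h; have E := eig_poly_factor h.
have c0 : peval p e * (-1) ^+ n != 0 by rewrite mulf_eq0 (negPf hyp.1) signr_eq0.
have lc : lead_coef (eig_poly p e x) = peval p e * (-1) ^+ n.
  by rewrite E lead_coefZ lead_coef_prod_XsubC mulr1.
have : [set s : seq R | eig_poly p e x =
    lead_coef (eig_poly p e x) *: \prod_(r <- s) ('X - r%:P)] (eigenvalues p e x).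
  by apply: (xgetPex [::]); exists (tval l) => /=; rewrite lc.
rewrite /= lc E => /(scalerI c0) h2.
by apply: prod_XsubC_eq; rewrite h2.
Qed.

Lemma real_spectrum_scale_shift x l (s t : R) : real_spectrum x l ->
  real_spectrum (s *: x + t *: e) [tuple s * tnth l i + t | i < n].
Proof.
move=> h; rewrite /real_spectrum cvecDZ cvecZ.
have := spectrum_shift (ri t) (spectrum_scale hp (ri s) h).
congr (spectrum _ _ _ _); apply: eq_from_tnth => i.
by rewrite !tnth_mktuple rmorphD rmorphM.
Qed.

Lemma real_spectrum_dir : real_spectrum e [tuple 1 | i < n].
Proof.
have [l hl] := real_spectrum_exists 0.
have := real_spectrum_scale_shift 0 1 hl; rewrite scaler0 add0r scale1r.
congr (real_spectrum _ _); apply: eq_from_tnth => i.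
by rewrite !tnth_mktuple mul0r add0r.
Qed.

(* q x = prod_s sum_j w_j lambda_(s j) x is, as a symmetric function of the
   eigenvalues, a polynomial in x; it is hyperbolic along e, and its smallest
   eigenvalue min_s sum_j w_j lambda_(s j) x is concave by Garding's theorem. *)
Lemma weighted_spectrum_concave x y lx ly lz (w : 'I_n -> R) (a : R) :
  (forall j, 0 < w j) -> \sum_(j < n) w j = 1 -> 0 <= a <= 1 ->
  real_spectrum x lx -> real_spectrum y ly ->
  real_spectrum (a *: x + (1 - a) *: y) lz ->
  exists s t : 'S_n, a * (\sum_j w j * tnth lx (s j)) +
    (1 - a) * (\sum_j w j * tnth ly (t j)) <= \sum_j w j * tnth lz j.
Proof.
move=> w0 w1 /andP[a0 a1] hx hy hz.
have [q hq qE] : exists2 q : mpoly.mpoly m R,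
    q \is mpoly.ishomog1 #|{: 'S_n}| (@mpoly.mdeg m) &
    forall v c, spectrum p e v c -> ceval q v =
      \prod_(s : 'S_n) \sum_(j < n) ri (w j) * tnth c (s j).
  have [h z|q hq qE] := homog_symmetric_spectrum hp hyp.1 (d := #|{: 'S_n}|)
      (weighted_orbit_prod_sym w).
    rewrite !mmap_weighted_orbit_prod -prodr_const -big_split /=.
    apply: eq_bigr => s _; rewrite mulr_sumr.
    by apply: eq_bigr => j _; rewrite mulrCA.
  by exists q => // v c hc; rewrite (qE _ _ hc) mmap_weighted_orbit_prod.
pose L l (s : 'S_n) := \sum_j w j * tnth l (s j).
have qR v l : real_spectrum v l -> peval q v = \prod_(s : 'S_n) L l s.
  move=> h; apply: (@complex.complexI R); rewrite -ceval_cvec (qE _ _ h) rmorph_prod.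
  apply: eq_bigr => s _; rewrite rmorph_sum; apply: eq_bigr => j _.
  by rewrite tnth_mktuple rmorphM.
have LS l (c d : R) (s : 'S_n) : L [tuple c * tnth l i + d | i < n] s = c * L l s + d.
  rewrite /L -[in RHS](mulr1 d) -w1 !mulr_sumr -big_split /=.
  by apply: eq_bigr => j _; rewrite tnth_mktuple; ring.
have qhyp : hyperbolic q e.
  split.
    rewrite (qR _ _ real_spectrum_dir); apply/prodf_neq0 => s _.
    rewrite (_ : L _ _ = 1) ?oner_eq0 // /L -[RHS]w1.
    by apply: eq_bigr => j _; rewrite tnth_mktuple mulr1.
  move=> v z; have [l hl] := real_spectrum_exists v.
  rewrite -scaleNr (qE _ _ (spectrum_shift (- z) hl)) => /eqP.
  move=> /prodf_eq0[s _ /eqP hs].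
  suff zE : \sum_(j < n) ri (w j) * tnth [tuple tnth [tuple ri (tnth l i) | i < n] i
      - z | i < n] (s j) = ri (L l s) - z.
    by move: hs; rewrite zE => /subr0_eq <-.
  rewrite -[X in _ - X]mul1r -[X in X * z]/(ri 1) -w1 !rmorph_sum mulr_suml -sumrB.
  by apply: eq_bigr => j _; rewrite !tnth_mktuple rmorphM mulrBr.
have qpos v l : real_spectrum v l -> (forall s, 0 < L l s) -> positive_dir q e v.
  move=> hl l0 t t0; have := real_spectrum_scale_shift 1 t hl; rewrite scale1r.
  move=> /qR ->; apply/prodf_neq0 => s _; rewrite LS mul1r gt_eqF //.
  by rewrite ltr_pwDl.
have minL l : exists s, forall t, L l s <= L l t.
  by case: (@arg_minP _ _ _ (1%g : 'S_n) xpredT (L l)) => // s _ h; exists s => t; apply: h.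
have [s hs] := minL lx; have [t ht] := minL ly; exists s, t.
rewrite -/(L lx s) -/(L ly t) leNgt; apply/negP => lt.
have lzE : \sum_j w j * tnth lz j = L lz 1%g.
  by apply: eq_bigr => j _; rewrite perm1.
set M := a * _ + _ in lt; set T := \sum_j _ in lt lzE.
(* Shift x and y along e until their least weighted sums equal ep. Adding ep e to the combination
   lands exactly at a x + (1 - a) y - T e, where q must not vanish; but the identity permutation
   contributes the factor T - T = 0. *)
pose ep := (M - T) / 2; have ep0 : 0 < ep by rewrite divr_gt0 // subr_gt0.
have px : positive_dir q e (1 *: x + (ep - L lx s) *: e).
  apply: qpos (real_spectrum_scale_shift 1 _ hx) _ => s'.
  by rewrite LS mul1r; have := hs s'; lra.
have py : positive_dir q e (1 *: y + (ep - L ly t) *: e).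
  apply: qpos (real_spectrum_scale_shift 1 _ hy) _ => s'.
  by rewrite LS mul1r; have := ht s'; lra.
have b0 : 0 <= 1 - a by lra.
have := positive_dir_add hq qhyp px py ep0 a0 b0.
rewrite (_ : ep *: e + _ + _ = 1 *: (a *: x + (1 - a) *: y) + (- T) *: e).
  rewrite (qR _ _ (real_spectrum_scale_shift 1 _ hz)) => /prodf_neq0/(_ 1%g isT).
  by rewrite LS mul1r -lzE subrr eqxx.
by apply/rowP => i; rewrite !mxE /ep /M; field.
Qed.

End RealSpectrum.

(** * Concavity of the smoothed smallest eigenvalue *)

Section SoftMin.
Variables (R : realType) (n : nat).
Implicit Types (l w : 'I_n -> R) (mu : R).

Lemma ln_le_subr1 (x : R) : 0 < x -> ln x <= x - 1.
Proof. by move=> x0; have := expR_ge1Dx (ln x); rewrite lnK ?posrE //; lra. Qed.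

Lemma sum_expR_gt0 l : (0 < n)%N -> 0 < \sum_(j < n) expR (l j).
Proof.
case: n l => // k l _; rewrite big_ord_recl ltr_pwDl ?expR_gt0 //.
by apply: sumr_ge0 => i _; exact: expR_ge0.
Qed.

(** Gibbs' inequality: ln v <= v - 1 at the ratio v of the normalized exponential to the weight,
    summed with weights w; equality holds at the normalized exponentials themselves. *)
Lemma softmin_le_entropy mu l w : (0 < n)%N -> 0 < mu ->
  (forall j, 0 < w j) -> \sum_j w j = 1 ->
  - mu * ln (\sum_(j < n) expR (- l j / mu)) <=
  \sum_j w j * l j + mu * \sum_j w j * ln (w j).
Proof.
move=> n0 mu0 w0 w1; set Z := \sum_(j < n) expR _.
have Z0 : 0 < Z by exact: sum_expR_gt0.
have h j : w j * (- l j / mu - ln Z - ln (w j)) <= expR (- l j / mu) / Z - w j.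
  have v0 : 0 < expR (- l j / mu) / Z / w j by rewrite !divr_gt0 ?expR_gt0.
  have := ln_le_subr1 v0.
  rewrite !ln_div ?posrE ?divr_gt0 ?expR_gt0 // expRK => h.
  have E : w j * (expR (- l j / mu) / Z / w j - 1) = expR (- l j / mu) / Z - w j.
    by field; rewrite !gt_eqF.
  by rewrite -E ler_pM2l.
have : \sum_j w j * (- l j / mu - ln Z - ln (w j)) <= 0.
  apply: le_trans (_ : _ <= \sum_j (expR (- l j / mu) / Z - w j)) _.
    by apply: ler_sum => j _; exact: h.
  by rewrite sumrB -mulr_suml w1 divff ?gt_eqF // subrr.
have -> : \sum_j w j * (- l j / mu - ln Z - ln (w j)) =
   - (\sum_j w j * l j) / mu - ln Z - \sum_j w j * ln (w j).
  rewrite -[in RHS](mul1r (ln Z)) -w1 mulr_suml mulNr mulr_suml -!sumrN -!big_split /=.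
  by apply: eq_bigr => j _; ring.
move=> /(ler_wpM2l (ltW mu0)).
have -> : mu * (- (\sum_j w j * l j) / mu - ln Z - \sum_j w j * ln (w j)) =
  - (\sum_j w j * l j) - mu * ln Z - mu * \sum_j w j * ln (w j).
  by field; rewrite gt_eqF.
lra.
Qed.

Lemma softmin_eq_entropy mu l : (0 < n)%N -> 0 < mu ->
  exists w, [/\ forall j, 0 < w j, \sum_j w j = 1 &
   - mu * ln (\sum_(j < n) expR (- l j / mu)) =
   \sum_j w j * l j + mu * \sum_j w j * ln (w j)].
Proof.
move=> n0 mu0; set Z := \sum_(j < n) expR _.
have Z0 : 0 < Z by exact: sum_expR_gt0.
have wsum : \sum_(j < n) (expR (- l j / mu) / Z) = 1.
  by rewrite -mulr_suml divff ?gt_eqF.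
exists (fun j => expR (- l j / mu) / Z); split=> // [j|].
  by rewrite divr_gt0 ?expR_gt0.
rewrite mulr_sumr -big_split /= -[LHS]mulr1 -wsum mulr_sumr.
apply: eq_bigr => j _; rewrite ln_div ?posrE ?expR_gt0 // expRK.
by field; rewrite !gt_eqF.
Qed.

Lemma softmin_le_all mu l j : 0 < mu ->
  - mu * ln (\sum_(j < n) expR (- l j / mu)) <= l j.
Proof.
move=> mu0; have n0 : (0 < n)%N by case: (n) j => // -[].
have : expR (- l j / mu) <= \sum_(j < n) expR (- l j / mu).
  by rewrite (bigD1 j) //= lerDl sumr_ge0 // => i _; exact: expR_ge0.
rewrite -ler_ln ?posrE ?expR_gt0 ?sum_expR_gt0 // expRK => h.
have := ler_wpM2l (ltW mu0) h; rewrite mulNr mulrN mulrCA divff ?gt_eqF //.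
lra.
Qed.

Lemma softmin_ge mu l c : (0 < n)%N -> 0 < mu -> (forall j, c <= l j) ->
  c - mu * ln n%:R <= - mu * ln (\sum_(j < n) expR (- l j / mu)).
Proof.
move=> n0 mu0 hl.
have : \sum_(j < n) expR (- l j / mu) <= n%:R * expR (- c / mu).
  rewrite -[n in n%:R]card_ord mulr_natl -sumr_const; apply: ler_sum => j _.
  by rewrite ler_expR ler_pM2r ?invr_gt0 // lerN2.
rewrite -ler_ln ?posrE ?mulr_gt0 ?ltr0n ?expR_gt0 ?sum_expR_gt0 //.
rewrite lnM ?posrE ?ltr0n ?expR_gt0 // expRK => h.
have := ler_wpM2l (ltW mu0) h; rewrite mulrDr mulNr mulrN mulrCA divff ?gt_eqF //.
lra.
Qed.

End SoftMin.

Section Fhat.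
Variables (R : realType) (m n : nat) (p : mpoly.mpoly m R) (e : 'rV[R]_m).
Hypothesis n0 : (0 < n)%N.
Hypothesis hp : p \is mpoly.ishomog1 n (@mpoly.mdeg m).
Hypothesis hyp : hyperbolic p e.
Implicit Types (x y : 'rV[R]_m) (l : n.-tuple R) (mu : R).

Lemma fhatE x l mu : real_spectrum p e x l ->
  fhat p e mu x = - mu * ln (\sum_(j < n) expR (- tnth l j / mu)).
Proof.
move=> h; rewrite /fhat (perm_big _ (eigenvalues_perm hyp h)) /=.
by rewrite big_tuple.
Qed.

(** The weights optimal for the combination serve as trial weights at x and y, with eigenvalues
    permuted by s and t; permuting does not change the sums of exponentials. *)
Lemma fhat_concave mu x y (a : R) : 0 < mu -> 0 <= a <= 1 ->
  a * fhat p e mu x + (1 - a) * fhat p e mu y <= fhat p e mu (a *: x + (1 - a) *: y).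
Proof.
move=> mu0 a01; have /andP[a0 a1] := a01.
have [lx hx] := real_spectrum_exists hp hyp x.
have [ly hy] := real_spectrum_exists hp hyp y.
have [lz hz] := real_spectrum_exists hp hyp (a *: x + (1 - a) *: y).
rewrite (fhatE _ hx) (fhatE _ hy) (fhatE _ hz).
have [w [w0 w1 ->]] := softmin_eq_entropy (tnth lz) n0 mu0.
have [s [t st]] := weighted_spectrum_concave hp hyp w0 w1 a01 hx hy hz.
have permE l (u : 'S_n) : \sum_(j < n) expR (- tnth l j / mu) =
    \sum_(j < n) expR (- tnth l (u j) / mu).
  by rewrite (reindex_inj (@perm_inj _ u)).
rewrite (permE lx s) (permE ly t).
have h1 := softmin_le_entropy (fun j => tnth lx (s j)) n0 mu0 w0 w1.
have h2 := softmin_le_entropy (fun j => tnth ly (t j)) n0 mu0 w0 w1.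
have b0 : 0 <= 1 - a by lra.
have := ler_wpM2l a0 h1; have := ler_wpM2l b0 h2; lra.
Qed.

(** Carries what is known at mu = 1, where the Lipschitz constant is defined, to every mu. *)
Lemma fhat_scale mu x : 0 < mu -> fhat p e mu x = mu * fhat p e 1 (mu^-1 *: x).
Proof.
move=> mu0; have [l hl] := real_spectrum_exists hp hyp x.
have := real_spectrum_scale_shift hp mu^-1 0 hl; rewrite scale0r addr0 => hl'.
rewrite (fhatE _ hl) (fhatE _ hl') mulN1r mulrN -mulNr; congr (_ * ln _).
by apply: eq_bigr => j _; rewrite tnth_mktuple addr0 divr1 mulNr [mu^-1 * _]mulrC.
Qed.

Lemma lambda_minP x l : real_spectrum p e x l ->
  (forall j, lambda_min p e x <= tnth l j) /\ exists j, lambda_min p e x = tnth l j.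
Proof.
move=> h; have pl := eigenvalues_perm hyp h; rewrite /lambda_min.
have mem_l r : r \in eigenvalues p e x -> exists j, r = tnth l j.
  by rewrite (perm_mem pl) => /tnthP.
have sz : (0 < size (eigenvalues p e x))%N by rewrite (perm_size pl) size_tuple.
split=> [j|].
  by apply: ge_bigmin_seq; rewrite ?(perm_mem pl) ?mem_tnth.
apply: mem_l; case: (eigenvalues p e x) sz => // a s _ /=.
rewrite big_seq; elim/big_ind: _ => [|y z|//]; first exact: mem_head.
by rewrite minEle; case: ifP.
Qed.

Lemma fhat_le_lambda_min mu x : 0 < mu -> fhat p e mu x <= lambda_min p e x.
Proof.
move=> mu0; have [l hl] := real_spectrum_exists hp hyp x.
have [_ [j ->]] := lambda_minP hl.
by rewrite (fhatE _ hl) softmin_le_all.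
Qed.

Lemma fhat_ge_lambda_min mu x : 0 < mu ->
  lambda_min p e x - mu * ln n%:R <= fhat p e mu x.
Proof.
move=> mu0; have [l hl] := real_spectrum_exists hp hyp x.
have [h _] := lambda_minP hl.
by rewrite (fhatE _ hl) softmin_ge.
Qed.

End Fhat.

(** * Differentiability of the smoothed smallest eigenvalue *)

Section HermiteInterpolation.
Variable R : realType.
Implicit Types (Q : {poly R}) (t rho : R).

Definition coef_norm (N : nat) (f : {poly R}) : R := \sum_(k < N) `|f`_k|.

(* Euclidean division of 'X^i by the monic polynomial Q, one power at a time, so
   that the quotient and the remainder grow at most geometrically with i. *)
Fixpoint Xn_divmod Q (i : nat) : {poly R} * {poly R} :=
  if i is j.+1 then
    let: (g, f) := Xn_divmod Q j in
    let c := f`_(size Q).-2 in (g * 'X + c%:P, f * 'X - c *: Q)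
  else (0, 1).

Lemma Xn_divmodP Q i : 'X^i = (Xn_divmod Q i).1 * Q + (Xn_divmod Q i).2.
Proof.
elim: i => [|i IH] /=; first by rewrite expr0 mul0r add0r.
rewrite exprSr IH; case: (Xn_divmod Q i) => g f /=.
by rewrite -mul_polyC; ring.
Qed.

(** B dominates both recursions: a step multiplies the norm of the remainder by at most 1 + |Q|, and
    adds to rho times the quotient at most the norm of the remainder. Growth B^i is absorbed by the
    i! of the exponential series. *)
Lemma Xn_divmod_bounds Q rho i : Q \is monic -> (1 < size Q)%N -> 0 <= rho ->
  let B := 1 + rho + coef_norm (size Q).-1 Q in
  [/\ (size (Xn_divmod Q i).2 <= (size Q).-1)%N,
      coef_norm (size Q).-1 (Xn_divmod Q i).2 <= B ^+ i &
      forall t, `|t| <= rho -> `|(Xn_divmod Q i).1.[t]| <= B ^+ i].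
Proof.
move=> mQ sQ rho0 B; set N := (size Q).-1.
have [K NK] : exists K, N = K.+1 by exists (size Q).-2; rewrite /N; case: (size Q) sQ => [|[]].
have sQE : size Q = K.+2 by rewrite -NK /N; case: (size Q) sQ.
have cn0 f : 0 <= coef_norm N f by apply: sumr_ge0.
have B1 : 1 <= B by rewrite /B -addrA lerDl addr_ge0.
elim: i => [|i [IH1 IH2 IH3]] /=.
  rewrite size_poly1 NK; split=> // [|t _]; last by rewrite horner0 normr0 expr0 ler01.
  rewrite expr0 /coef_norm big_ord_recl big1 ?addr0 ?coef1 ?normr1 // => k _.
  by rewrite coef1 normr0.
case: (Xn_divmod Q i) IH1 IH2 IH3 => g f /= IH1 IH2 IH3.
rewrite sQE /=; set c := f`_K.
have cB : `|c| <= coef_norm N f.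
  by rewrite /coef_norm NK (bigD1 ord_max) //= lerDl sumr_ge0.
have cB' := le_trans cB IH2.
split.
- apply/leq_sizeP => j; rewrite NK => jN.
  rewrite coefB coefMX coefZ; case: j jN => // j jN /=.
  have [eKj|neKj] := eqVneq j K.
    have Q1 : Q`_K.+1 = 1 by rewrite -(monicP mQ) /lead_coef sQE.
    by rewrite eKj -/c Q1 mulr1 subrr.
  have lt : (K < j)%N by rewrite ltn_neqAle eq_sym neKj.
  rewrite [f`_j]nth_default ?(leq_trans IH1) ?NK //.
  by rewrite [Q`_j.+1]nth_default ?mulr0 ?subrr // sQE.
- have h : coef_norm N (f * 'X - c *: Q) <= coef_norm N f + `|c| * coef_norm N Q.
    apply: le_trans (_ : _ <= \sum_(k < N) (`|(f * 'X)`_k| + `|c| * `|Q`_k|)) _.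
      apply: ler_sum => k _; rewrite coefB coefZ -normrM.
      exact: ler_normB.
    rewrite big_split /= -mulr_sumr lerD2r NK /coef_norm big_ord_recl big_ord_recr /=.
    rewrite coefMX /= normr0 add0r -[X in X <= _]addr0 lerD //.
    by apply: ler_sum => k _; rewrite coefMX.
  apply: le_trans h _; rewrite exprS.
  apply: le_trans (_ : _ <= B ^+ i + B ^+ i * coef_norm N Q) _.
    by rewrite lerD // ler_wpM2r.
  rewrite -{1}[B ^+ i]mulr1 -mulrDr mulrC ler_wpM2r ?exprn_ge0 ?(le_trans ler01) //.
  by rewrite /B -/N addrAC lerDl.
- move=> t ht; rewrite hornerMXaddC exprS.
  apply: le_trans (ler_normD _ _) _; rewrite normrM.
  apply: le_trans (_ : _ <= B ^+ i * rho + B ^+ i) _.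
    by rewrite lerD // ler_pM ?IH3.
  rewrite -{2}[B ^+ i]mulr1 -mulrDr mulrC ler_wpM2r ?exprn_ge0 ?(le_trans ler01) //.
  by rewrite /B addrC lerDl -/N.
Qed.

Lemma series_exp_coeff_le (x : R) M : 0 <= x -> series (exp_coeff x) M <= expR x.
Proof.
move=> x0; apply: nondecreasing_cvgn_le; last exact: is_cvg_series_exp_coeff.
by apply/nondecreasing_seqP => k; rewrite /series /= big_nat_recr //= lerDl exp_coeff_ge0.
Qed.

(** Each term t^i / i! is divided by Q: the remainders add up to r, and the quotients stay bounded
    by exp B on |t| <= rho. Multiple roots of Q need no separate treatment. *)
Lemma hermite_expR Q rho : Q \is monic -> (1 < size Q)%N -> 0 <= rho ->
  exists r : {poly R}, exists2 B : R, 0 < B &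
    forall t, `|t| <= rho -> `|expR t - r.[t]| <= B * `|Q.[t]|.
Proof.
move=> mQ sQ rho0; set N := (size Q).-1.
pose B := 1 + rho + coef_norm N Q.
have B0 : 0 <= B by rewrite !addr_ge0 // sumr_ge0.
pose rk k := [sequence (Xn_divmod Q i).2`_k / i`!%:R]_i.
have rk_cvg k : (k < N)%N -> cvgn (series (rk k)).
  move=> kN; apply: normed_cvg.
  apply: (@series_le_cvg _ _ (exp_coeff B)) => [i|i|i|]; last exact: is_cvg_series_exp_coeff.
  - by rewrite /=.
  - exact: exp_coeff_ge0.
  rewrite /= normrM normfV normr_nat ler_wpM2r ?invr_ge0 ?ler0n //.
  have [_ h _] := Xn_divmod_bounds i mQ sQ rho0.
  by apply: le_trans h; rewrite /coef_norm (bigD1 (Ordinal kN)) //= lerDl sumr_ge0.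
exists (\poly_(k < N) limn (series (rk k))); exists (expR B); first exact: expR_gt0.
move=> t ht; rewrite horner_poly.
(* The partial sums of exp t - r(t): each is exactly Q(t) times a partial sum of quotients, so the
   bound holds before passing to the limit. *)
pose u M := series (exp_coeff t) M - \sum_(k < N) series (rk k) M * t ^+ k.
have uM M : `|u M| <= expR B * `|Q.[t]|.
  have -> : u M = (\sum_(0 <= i < M) (Xn_divmod Q i).1.[t] / i`!%:R) * Q.[t].
    rewrite /u /series /=.
    under [X in _ - X]eq_bigr do rewrite mulr_suml.
    rewrite exchange_big /= -sumrB mulr_suml; apply: eq_bigr => i _.
    have [h1 _ _] := Xn_divmod_bounds i mQ sQ rho0.
    have := congr1 (horner^~ t) (Xn_divmodP Q i).
    rewrite /= hornerXn hornerD hornerM [X in _ + X](horner_coef_wide _ h1) => E.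
    rewrite /exp_coeff /= E mulrDl mulr_suml addrAC.
    rewrite (_ : \sum_(k < N) _ / _ = \sum_(k < N) (rk k i * t ^+ k)).
      by rewrite addrAC addrK; ring.
    by apply: eq_bigr => k _; rewrite /rk /= mulrAC.
  rewrite normrM ler_wpM2r //; apply: le_trans (series_exp_coeff_le M B0).
  apply: le_trans (ler_norm_sum _ _ _) _; apply: ler_sum => i _.
  rewrite normrM normfV normr_nat ler_wpM2r ?invr_ge0 ?ler0n //.
  by have [_ _] := Xn_divmod_bounds i mQ sQ rho0; apply.
have ucvg : u @ \oo --> expR t - \sum_(k < N) limn (series (rk k)) * t ^+ k.
  apply: cvgB; first exact: is_cvg_series_exp_coeff.
  apply: cvg_big => [|k _]; first exact: add_continuous.
  by apply: cvgMr_tmp; exact: rk_cvg.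
have : (fun M => `|u M|) @ \oo --> `|expR t - \sum_(k < N) limn (series (rk k)) * t ^+ k|.
  exact: cvg_norm.
move=> cu; have E := cvg_lim (@Rhausdorff R) cu; rewrite -E.
by apply: limr_le; [apply/cvg_ex; eexists; exact: cu | exact: nearW].
Qed.

End HermiteInterpolation.

Section SandwichDifferentiable.
Variables (R : realType) (V : normedModType R).
Implicit Types (f g W : V -> R) (x : V).

Lemma differentiable_eps f x (df : {linear V -> R}) : continuous df ->
  (forall eps : R, 0 < eps ->
     \forall h \near (0 : V), `|f (h + x) - (f x + df h)| <= eps * `|h|) ->
  differentiable f x.
Proof.
move=> dc hf.
have E : f \o shift x = cst (f x) + df +o_ (0 : V) id by apply/eqaddoP.
by apply/diff_locallyP; rewrite (diff_unique dc E).
Qed.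

Lemma differentiable_near f x (eps : R) : differentiable f x -> 0 < eps ->
  \forall h \near (0 : V), `|f (h + x) - (f x + 'd f x h)| <= eps * `|h|.
Proof. by move=> /diff_locallyP[_ /eqaddoP h] eps0; apply: h. Qed.

Lemma diff_at_zero_min W x : differentiable W x -> (forall y, 0 <= W y) -> W x = 0 ->
  forall v, 'd W x v = 0.
Proof.
move=> dW W0 Wx v; have [->|v0] := eqVneq v 0; first exact: raddf0.
have nv : 0 < `|v| by rewrite normr_gt0.
apply/eqP; rewrite -normr_le0; apply/ler_addgt0Pr => eps eps0; rewrite add0r.
have ev : 0 < eps / `|v| by exact: divr_gt0.
have /nbhs_ballP[d /= d0 hd] := differentiable_near dW ev.
pose s := d / 2 / `|v|; have s0 : 0 < s by rewrite !divr_gt0.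
have main (u : V) : `|u| = `|v| -> - 'd W x u <= eps.
  move=> uv; have /hd : ball 0 d (s *: u).
    rewrite -ball_normE /ball_ /= sub0r normrN normrZ gtr0_norm // uv divfK ?gt_eqF //.
    by rewrite ltr_pdivrMr // ltr_pMr // ltr1n.
  rewrite /= Wx add0r normrZ gtr0_norm // uv mulrCA divfK ?gt_eqF //.
  have -> : 'd W x (s *: u) = s * 'd W x u by rewrite linearZ.
  move=> h; have h2 := le_trans (ler_norm _) h.
  have h3 := W0 (s *: u + x).
  rewrite -(ler_pM2l s0) mulrN.
  lra.
rewrite ler_norml; apply/andP; split; last by have := main (- v) (normrN v); rewrite raddfN opprK.
by rewrite lerNl; exact: main.
Qed.

(** W has a minimum with value 0 at x, so its derivative there vanishes and W (h + x) = o(h); hence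
    f inherits the derivative of g. *)
Lemma sandwich_differentiable f g W x (B : R) :
  differentiable g x -> differentiable W x -> (forall y, 0 <= W y) -> W x = 0 ->
  (\forall y \near x, `|f y - g y| <= B * W y) -> 0 < B ->
  differentiable f x.
Proof.
move=> dg dW W0 Wx fg B0.
have fgx : f x = g x.
  have := nbhs_singleton fg; rewrite Wx mulr0 normr_le0.
  by move/eqP/subr0_eq.
apply: (@differentiable_eps f x ('d g x)); first exact: diff_continuous.
move=> eps eps0.
have fg0 : \forall h \near (0 : V), `|f (h + x) - g (h + x)| <= B * W (h + x).
  by have := fg; rewrite (near_shift 0) subr0.
have e2 : 0 < eps / 2 by exact: divr_gt0.
have e3 : 0 < eps / 2 / B by exact: divr_gt0.
near=> h.
have h1 : `|f (h + x) - g (h + x)| <= B * W (h + x) by near: h.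
have h2 : `|g (h + x) - (g x + 'd g x h)| <= eps / 2 * `|h|.
  by near: h; exact: differentiable_near.
have h3 : `|W (h + x) - (W x + 'd W x h)| <= eps / 2 / B * `|h|.
  by near: h; exact: differentiable_near.
rewrite Wx diff_at_zero_min // !addr0 subr0 ger0_norm // in h3.
have h4 := ler_wpM2l (ltW B0) h3.
rewrite fgx -[X in `|X|](subrKA (g (h + x))); apply: le_trans (ler_normD _ _) _.
apply: le_trans (lerD (le_trans h1 h4) h2) _.
by rewrite mulrA [B * _]mulrC divfK ?gt_eqF // -mulrDl -splitr.
Unshelve. all: by end_near.
Qed.

End SandwichDifferentiable.

Section Smoothness.
Variables (R : realType) (m n : nat) (p : mpoly.mpoly m R) (e : 'rV[R]_m).
Hypothesis n0 : (0 < n)%N.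
Hypothesis hp : p \is mpoly.ishomog1 n (@mpoly.mdeg m).
Hypothesis hyp : hyperbolic p e.
Implicit Types (x y : 'rV[R]_m) (l : n.-tuple R) (mu : R).

Lemma differentiable_peval (g : mpoly.mpoly m R) x : differentiable (peval g) x.
Proof.
elim/mpoly.mpolyind: g => [|c k g _ _ IH].
  rewrite (_ : peval 0 = cst 0); first exact: differentiable_cst.
  by apply/funext => y; rewrite /peval raddf0.
rewrite (_ : peval _ = c *: peval (mpoly.mpolyX R k) + peval g); last first.
  by apply/funext => y; rewrite /peval raddfD /= mpoly.mevalZ.
apply: differentiableD IH; apply: differentiableZ.
rewrite (_ : peval _ = \prod_(i < m) ((fun y : 'rV[R]_m => y 0 i) ^+ k i)); last first.
  apply/funext => y; rewrite /peval mpoly.mevalX fct_prodE.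
  by apply: eq_bigr => i _; rewrite exprfctE.
elim/big_ind: _ => [|a b|i _].
- exact: differentiable_cst.
- exact: differentiableM.
- case: (k i) => [|a]; first by rewrite expr0; exact: differentiable_cst.
  apply: differentiableX; exact: differentiable_coord.
Qed.

Lemma poly_sum_spectrum (h : {poly R}) : exists g : mpoly.mpoly m R,
  forall x l, real_spectrum p e x l -> peval g x = \sum_(j < n) h.[tnth l j].
Proof.
have [g hg] := symmetric_spectrum hyp.1 (poly_sum_sym n h).
exists g => x l hl; apply: (@complex.complexI R); rewrite -ceval_cvec (hg _ _ hl).
rewrite mmap_poly_sum rmorph_sum; apply: eq_bigr => j _.
by rewrite tnth_mktuple horner_map.
Qed.

(* With Q = prod_j ('X + lambda_j x)^2 and r the interpolant of hermite_expR,
   sum_j r (- lambda_j y) and W y = sum_j Q (- lambda_j y) are polynomials in y,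
   W is nonnegative and vanishes at x, and the sum of the exponentials is within
   B * W of the first one near x. *)
Lemma differentiable_sum_expR x :
  differentiable (fun y => \sum_(r <- eigenvalues p e y) expR (- r)) x.
Proof.
have [l0 hl0] := real_spectrum_exists hp hyp x.
pose P0 : {poly R} := \prod_(j < n) ('X - (- tnth l0 j)%:P).
pose Q := P0 ^+ 2.
have mP : P0 \is monic by exact: monic_prod_XsubC.
have mQ : Q \is monic by rewrite /Q expr2 monicMl.
have sQ : (1 < size Q)%N.
  rewrite /Q expr2 size_monicM ?monic_neq0 // /P0 size_prod_XsubC /index_enum -enumT.
  by rewrite size_enum_ord; case: (n) n0 => // k _; rewrite addSn /= addnS.
(* The sum of squared eigenvalues is continuous in x and controls all eigenvalues at once. Near x it
   is below N2 x + 1, and 2 |lambda| <= lambda^2 + 1 then gives |lambda| <= N2 x + 2, the radius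
   chosen for the interpolant. *)
have [N2 hN2] := poly_sum_spectrum 'X^2.
have N2_ge y : 0 <= peval N2 y.
  have [l hl] := real_spectrum_exists hp hyp y; rewrite (hN2 _ _ hl).
  by apply: sumr_ge0 => j _; rewrite hornerXn sqr_ge0.
have rho0 : 0 <= peval N2 x + 2 by rewrite addr_ge0.
have [r [B B0 hr]] := hermite_expR mQ sQ rho0.
have [g hg] := poly_sum_spectrum (r \Po (- 'X)).
have [W hW] := poly_sum_spectrum (Q \Po (- 'X)).
have hornN (f : {poly R}) t : (f \Po (- 'X)).[t] = f.[- t].
  by rewrite horner_comp hornerN hornerX.
apply: (@sandwich_differentiable _ _ _ (peval g) (peval W) x B).
- exact: differentiable_peval.
- exact: differentiable_peval.
- move=> y; have [l hl] := real_spectrum_exists hp hyp y; rewrite (hW _ _ hl).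
  by apply: sumr_ge0 => j _; rewrite hornN /Q horner_exp sqr_ge0.
- rewrite (hW _ _ hl0) big1 // => j _; rewrite hornN /Q horner_exp /P0 horner_prod.
  by rewrite (bigD1 j) //= hornerXsubC subrr mul0r expr0n.
- have c2 : {for x, continuous (peval N2)}.
    by apply: differentiable_continuous; exact: differentiable_peval.
  have lt1 : peval N2 x < peval N2 x + 1 by rewrite ltrDl.
  have : \forall y \near x, peval N2 y < peval N2 x + 1 by exact: (cvgr_lt _ c2).
  apply: filterS => y hy; have [l hl] := real_spectrum_exists hp hyp y.
  rewrite (hg _ _ hl) (hW _ _ hl) (perm_big _ (eigenvalues_perm hyp hl)) /=.
  rewrite big_tuple -sumrB mulr_sumr.
  apply: le_trans (ler_norm_sum _ _ _) _; apply: ler_sum => j _.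
  rewrite !hornN -[Q.[_]]ger0_norm; last by rewrite /Q horner_exp sqr_ge0.
  apply: hr; rewrite normrN.
  have : `|tnth l j| ^+ 2 <= peval N2 y.
    rewrite (hN2 _ _ hl) (bigD1 j) //= hornerXn real_normK ?num_real // lerDl.
    by apply: sumr_ge0 => i _; rewrite hornerXn sqr_ge0.
  by have := sqr_ge0 (`|tnth l j| - 1); nra.
- exact: B0.
Qed.

Lemma differentiable_fhat mu x : 0 < mu -> differentiable (fhat p e mu) x.
Proof.
move=> mu0.
have S0 y : 0 < \sum_(r <- eigenvalues p e y) expR (- r).
  have [l hl] := real_spectrum_exists hp hyp y.
  by rewrite (perm_big _ (eigenvalues_perm hyp hl)) /= big_tuple sum_expR_gt0.
have d1 y : differentiable (fhat p e 1) y.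
  rewrite (_ : fhat p e 1 = (- 1) *: (@ln R \o (fun y =>
      \sum_(r <- eigenvalues p e y) expR (- r)))); last first.
    apply/funext => z; rewrite /fhat /=; congr (_ * ln _).
    by apply: eq_bigr => r _; rewrite divr1.
  apply/differentiableZ/differentiable_comp; first exact: differentiable_sum_expR.
  by apply/derivable1_diffP; have := is_derive1_ln (S0 y) => -[].
rewrite (_ : fhat p e mu = mu *: (fhat p e 1 \o ( *:%R mu^-1))); last first.
  by apply/funext => y; rewrite (fhat_scale hp hyp).
apply/differentiableZ/differentiable_comp => //.
Qed.

End Smoothness.

(** * The hyperbolicity cone *)

Section HyperbolicityCone.
Variables (R : realType) (m n : nat) (p : mpoly.mpoly m R) (K : set 'rV[R]_m).
Local Notation ri := (complex.real_complex R).
Hypothesis hK : hyperbolicity_cone p n K.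
Implicit Types (x y e : 'rV[R]_m).

Lemma cone_homog : p \is mpoly.ishomog1 n (@mpoly.mdeg m).
Proof. by case: hK. Qed.

Lemma cone_scale x (t : R) : 0 <= t -> K x -> K (t *: x).
Proof. by case: hK => -[_ _ h _ _] _ _ _; apply: h. Qed.

Lemma cone_add x y : K x -> K y -> K (x + y).
Proof.
move=> Kx Ky; case: hK => -[_ cK _ _ _] _ _ _.
have h0 : 0 <= 2^-1 :> R by rewrite invr_ge0.
have h1 : 2^-1 <= 1 :> R by rewrite invf_le1 // ler1n.
have := cK (2 *: x) (2 *: y) (Itv01 h0 h1).
have mem2 z : K z -> 2 *: z \in K by move=> Kz; apply/mem_set/cone_scale.
move=> /(_ (mem2 _ Kx) (mem2 _ Ky)) /set_mem.
rewrite /conv /= /unstable.onem !scalerA mulVf // scale1r.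
by rewrite (_ : (1 - 2^-1) * 2 = 1) ?scale1r //; field.
Qed.

Lemma int_cone x : K° x -> K x.
Proof. exact: interior_subset. Qed.

Lemma int_cone_add x y : K° x -> K y -> K° (x + y).
Proof.
move=> Kx Ky; suff : \forall z \near (x + y), K z by [].
rewrite (near_shift x); apply: filterS Kx => z Kz /=.
by rewrite [x + y]addrC addrK; exact: cone_add.
Qed.

Lemma int_cone_neq0 x : K° x -> peval p x != 0.
Proof.
case: hK => _ _ [x0 _ ->] _; exact: connected_component_sub.
Qed.

Lemma map_eig_poly e x :
  map_poly ri (eig_poly p e x) = line_poly p (cvec x) (- cvec e).
Proof.
rewrite /eig_poly /line_poly mmap_rmorph; apply: eq_mmap => [r|i] /=.
  by rewrite map_polyC.
rewrite rmorphB /= map_polyC map_polyZ /= map_polyX !mxE /= -mul_polyC.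
by rewrite polyCN mulNr.
Qed.

(** The definition grants real roots along one interior direction e0. Every interior e is a positive
    direction for e0, since e + s e0 stays interior, where p does not vanish; [hyperbolic_dir]
    concludes. *)
Lemma cone_hyperbolic e : K° e -> hyperbolic p e.
Proof.
move=> Ke; case: (hK) => _ _ _ [e0 Ke0 h0].
have hyp0 : hyperbolic p e0.
  split; first exact: int_cone_neq0.
  move=> x z hz; apply: (h0 x); rewrite map_eig_poly.
  by apply/rootP; rewrite horner_line_poly scalerN.
apply: (hyperbolic_dir cone_homog hyp0) => s s0.
by apply/int_cone_neq0/int_cone_add => //; apply/cone_scale/int_cone.
Qed.

Variable e : 'rV[R]_m.
Hypotheses (n0 : (0 < n)%N) (Ke : K° e).
Let hyp := cone_hyperbolic Ke.

Lemma lambda_min_scale_shift x (s t : R) : 0 <= s ->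
  lambda_min p e (s *: x + t *: e) = s * lambda_min p e x + t.
Proof.
move=> s0; have [l hl] := real_spectrum_exists cone_homog hyp x.
have hl' := real_spectrum_scale_shift cone_homog s t hl.
have [h1 [i hi]] := lambda_minP n0 hyp hl.
have [h2 [j hj]] := lambda_minP n0 hyp hl'.
apply/le_anti/andP; split.
  by rewrite hi; have := h2 i; rewrite tnth_mktuple.
by rewrite hj tnth_mktuple lerD2r ler_wpM2l.
Qed.

Lemma peval_spectrum x l : real_spectrum p e x l ->
  peval p x = peval p e * \prod_(i < n) tnth l i.
Proof.
move=> /real_spectrumE/(_ 0); rewrite scale0r subr0 => ->; congr (_ * _).
by apply: eq_bigr => i _; rewrite subr0.
Qed.

Lemma lambda_min_gt0_neq0 x : 0 < lambda_min p e x -> peval p x != 0.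
Proof.
move=> h; have [l hl] := real_spectrum_exists cone_homog hyp x.
rewrite (peval_spectrum hl) mulf_neq0 ?int_cone_neq0 //.
apply/prodf_neq0 => i _; rewrite gt_eqF //; apply: lt_le_trans h _.
by have [] := lambda_minP n0 hyp hl.
Qed.

Lemma cone_lambda_min_ge0 x : K x -> 0 <= lambda_min p e x.
Proof.
move=> Kx; rewrite leNgt; apply/negP => l0.
(* With this s the interior point e + s x would have the eigenvalue 1 + s lambda_min x = 0. *)
pose s := (- lambda_min p e x)^-1.
have s0 : 0 < s by rewrite invr_gt0 oppr_gt0.
have := int_cone_neq0 (int_cone_add Ke (cone_scale (ltW s0) Kx)).
have [l hl] := real_spectrum_exists cone_homog hyp x.
have hl' := real_spectrum_scale_shift cone_homog s 1 hl.
have [_ [i hi]] := lambda_minP n0 hyp hl.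
rewrite addrC -[e in _ + e]scale1r (peval_spectrum hl') (bigD1 i) //=.
have E : s * lambda_min p e x + 1 = 0 by rewrite /s; field; rewrite lt_eqF.
by rewrite tnth_mktuple -hi E mul0r mulr0 eqxx.
Qed.

(** On the segment from e to x, [lambda_min] stays positive and p nonzero, so x lies in the
    component of e, which is the interior of K. *)
Lemma lambda_min_gt0_int x : 0 < lambda_min p e x -> K° x.
Proof.
move=> lx; case: (hK) => _ _ [x0 px0 KE] _; rewrite KE.
pose f (t : R) : 'rV[R]_m := t *: x + (1 - t) *: e.
have f0 : f 0 = e by rewrite /f scale0r add0r subr0 scale1r.
have f1 : f 1 = x by rewrite /f subrr scale0r addr0 scale1r.
have fc : continuous f.
  move=> t; apply: cvgD; first by apply: cvgZr_tmp; exact: cvg_id.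
  by apply: cvgZr_tmp; apply: cvgB; [exact: cvg_cst|exact: cvg_id].
have ec : connected_component [set y | peval p y != 0] x0 e by rewrite -KE.
rewrite (same_connected_component ec).
have conn : connected (f @` `[0, 1]).
  apply: connected_continuous_connected; first exact: segment_connected.
  exact: continuous_subspaceT.
apply: (connected_component_max _ _ conn).
- by exists 0 => //=; rewrite in_itv /= lexx ler01.
- move=> _ [t /= /[!in_itv] /= /andP[t0 t1] <-].
  apply: lambda_min_gt0_neq0; rewrite lambda_min_scale_shift //.
  have [->|t0'] := eqVneq t 0; first by rewrite mul0r add0r subr0 ltr01.
  by rewrite ltr_pwDl ?subr_ge0 // mulr_gt0 // lt_neqAle eq_sym t0'.
- by exists 1 => //=; rewrite in_itv /= lexx ler01.
Qed.

Lemma lambda_min_ge0_cone x : 0 <= lambda_min p e x -> K x.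
Proof.
move=> lx; have cK : closed K by case: hK => -[].
have : (fun t : R => x + t *: e) @ 0^'+ --> x + 0 *: e.
  apply: cvgD; first exact: cvg_cst.
  apply: cvgZr_tmp; apply: cvg_within_filter; exact: cvg_id.
rewrite scale0r addr0; apply: (closed_cvg K cK).
near=> t; apply/int_cone/lambda_min_gt0_int.
have t0 : 0 < t by near: t; exact: nbhs_right_gt.
by rewrite -[x in x + _]scale1r lambda_min_scale_shift // mul1r ltr_wpDl.
Unshelve. all: by end_near.
Qed.

Lemma lambda_min_ray x (s : R) : 0 <= s ->
  lambda_min p e (e + s *: (x - e)) = 1 - s * (1 - lambda_min p e x).
Proof.
move=> s0; rewrite (_ : e + s *: (x - e) = s *: x + (1 - s) *: e).
  by rewrite lambda_min_scale_shift //; ring.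
by rewrite scalerBr scalerBl scale1r addrCA addrA.
Qed.

End HyperbolicityCone.

(** * Gradients for an arbitrary inner product *)

Section DotProduct.
Variables (R : realType) (m : nat) (ip : {dot 'rV[R]_m for idfun}).
Implicit Types (u v w x y : 'rV[R]_m).

Lemma ipC u v : ip u v = ip v u.
Proof. by have := hermC ip u v; rewrite expr0 mul1r. Qed.

Lemma ipDl u v w : ip (u + v) w = ip u w + ip v w.
Proof. exact: linearDl. Qed.

Lemma ipNl u w : ip (- u) w = - ip u w.
Proof. exact: linearNl. Qed.

Lemma ipZl a u w : ip (a *: u) w = a * ip u w.
Proof. exact: linearZl_LR. Qed.

Lemma ipDr u v w : ip w (u + v) = ip w u + ip w v.
Proof. exact: linearDr. Qed.

Lemma ipNr u w : ip w (- u) = - ip w u.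
Proof. exact: linearNr. Qed.

Lemma ipZr a u w : ip w (a *: u) = a * ip w u.
Proof. exact: linearZr_LR. Qed.

Lemma ip0l w : ip 0 w = 0.
Proof. exact: linear0l. Qed.

Lemma ip0r w : ip w 0 = 0.
Proof. exact: linear0r. Qed.

Definition ipE := (ipDl, ipNl, ipZl, ipDr, ipNr, ipZr, ip0l, ip0r).

Lemma ip_gt0 u : u != 0 -> 0 < ip u u.
Proof. exact: neq0_dnorm_gt0. Qed.

Lemma ip_ge0 u : 0 <= ip u u.
Proof. by have [->|/ip_gt0/ltW//] := eqVneq u 0; rewrite ip0l. Qed.

Lemma ip_eq0 u : ip u u = 0 -> u = 0.
Proof. by move=> h; apply/eqP/negPn/negP => /ip_gt0; rewrite h ltxx. Qed.

Lemma ipnorm_sqr u : ipnorm ip u ^+ 2 = ip u u.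
Proof. by rewrite sqr_sqrtr ?ip_ge0. Qed.

Lemma ipnorm_ge0 u : 0 <= ipnorm ip u.
Proof. exact: sqrtr_ge0. Qed.

(** Riesz representation on a subspace, by inverting the Gram matrix of a basis. It yields gradients
    when W is the full space, and orthogonal projections when W is the level space. *)
Lemma riesz_vspace (W : {vspace 'rV[R]_m}) (phi : 'rV[R]_m -> R) :
  (forall a u v, phi (a *: u + v) = a * phi u + phi v) ->
  exists2 u, u \in W & forall w, w \in W -> ip u w = phi w.
Proof.
move=> lphi.
have phi0 : phi 0 = 0.
  have := lphi 1 0 0; rewrite scale1r addr0 mul1r => /eqP.
  by rewrite -subr_eq0 opprD addNKr oppr_eq0 => /eqP.
have phi_sum k (X : 'I_k -> 'rV[R]_m) (c : 'I_k -> R) :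
    phi (\sum_(i < k) c i *: X i) = \sum_(i < k) c i * phi (X i).
  elim: k X c => [|k IH] X c; first by rewrite !big_ord0.
  by rewrite !big_ord_recl lphi IH.
have ip_suml k (X : 'I_k -> 'rV[R]_m) (c : 'I_k -> R) w :
    ip (\sum_(i < k) c i *: X i) w = \sum_(i < k) c i * ip (X i) w.
  elim: k X c => [|k IH] X c; first by rewrite !big_ord0 ip0l.
  by rewrite !big_ord_recl ipDl ipZl IH.
have ip_sumr k (X : 'I_k -> 'rV[R]_m) (c : 'I_k -> R) w :
    ip w (\sum_(i < k) c i *: X i) = \sum_(i < k) c i * ip w (X i).
  by rewrite ipC ip_suml; apply: eq_bigr => i _; rewrite ipC.
pose X := vbasis W; pose k := \dim W.
have bX : basis_of W X := vbasisP W.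
pose G : 'M[R]_k := \matrix_(i, j) ip X`_i X`_j.
have Gu : G \in unitmx.
  rewrite -row_free_unit; apply: inj_row_free => c cG.
  have c0 : \sum_(i < k) c 0 i *: X`_i = 0.
    apply: ip_eq0; rewrite ip_sumr big1 // => j _; rewrite ip_suml.
    rewrite (_ : \sum_(i < k) _ = (c *m G) 0 j); first by rewrite cG mxE mulr0.
    by rewrite mxE; apply: eq_bigr => i _; rewrite mxE.
  have /freeP/(_ (fun i => c 0 i)) := basis_free bX.
  by move=> /(_ c0) h; apply/rowP => i; rewrite h mxE.
pose c : 'rV[R]_k := (\row_j phi X`_j) *m invmx G.
exists (\sum_(i < k) c 0 i *: X`_i).
  apply: rpred_sum => i _; apply: rpredZ; apply: vbasis_mem.
  by rewrite mem_nth // size_tuple.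
move=> w wW; rewrite (coord_vbasis wW) ip_sumr phi_sum; apply: eq_bigr => j _.
congr (_ * _); rewrite ip_suml.
have : (c *m G) 0 j = phi X`_j by rewrite /c mulmxKV // mxE.
by rewrite mxE => <-; apply: eq_bigr => i _; rewrite [G i j]mxE.
Qed.

Lemma gradP (f : 'rV[R]_m -> R) x : differentiable f x ->
  forall v, 'd f x v = ip (grad ip f x) v.
Proof.
move=> df; have [g _ hg] : exists2 u, u \in fullv & forall w, w \in fullv ->
    ip u w = 'd f x w by apply: riesz_vspace => a u v; rewrite linearP.
have : exists g, differentiable f x /\ forall v, 'd f x v = ip g v.
  by exists g; split=> // v; rewrite hg ?memvf.
by move=> /(xgetPex 0)[].
Qed.

Lemma grad_unique (f : 'rV[R]_m -> R) x g : differentiable f x ->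
  (forall v, 'd f x v = ip g v) -> grad ip f x = g.
Proof.
move=> df hg; apply/subr0_eq/ip_eq0; rewrite {1}ipDl ipNl -gradP // hg.
exact: subrr.
Qed.

Variables (L : set 'rV[R]_m) (W : {vspace 'rV[R]_m}).
Hypothesis LW : forall v, L v <-> v \in W.

Lemma ortho_projP v : L (ortho_proj ip L v) /\
  forall w, L w -> ip (ortho_proj ip L v) w = ip v w.
Proof.
have [u uW hu] : exists2 u, u \in W & forall w, w \in W -> ip u w = ip v w.
  by apply: riesz_vspace => a u w; rewrite ipDr ipZr.
have : exists u, L u /\ forall w, L w -> ip (v - u) w = 0.
  exists u; split; first exact/LW.
  by move=> w /LW wW; rewrite ipDl ipNl hu // subrr.
move=> /(xgetPex 0)[h1 h2]; split=> // w /h2.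
by rewrite ipDl ipNl => /subr0_eq.
Qed.

End DotProduct.

Section LevelSpace.
Variables (R : realType) (m : nat) (dot : {dot 'rV[R]_m for idfun}).

Lemma level_space_vspace (c : 'rV[R]_m) (D : {vspace 'rV[R]_m}) :
  exists W : {vspace 'rV[R]_m}, forall v, level_space dot c D v <-> v \in W.
Proof.
have lin : linear (fun v => dot c v : R^o).
  by move=> a u v; rewrite ipDr ipZr.
pose f : {linear 'rV[R]_m -> R^o} := HB.pack (fun v => dot c v : R^o)
  (GRing.isLinear.Build _ _ _ _ _ lin).
exists (D :&: lker (linfun f))%VS => v.
rewrite memv_cap memv_ker lfunE /=; split=> [[vD /eqP cv]|/andP[vD /eqP cv]].
  by apply/andP.
by split.
Qed.

End LevelSpace.

Section ConcaveGradient.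
Variables (R : realType) (V : normedModType R).

Lemma concave_le_diff (f : V -> R) (x y : V) :
  (forall u v (a : R), 0 <= a <= 1 ->
     a * f u + (1 - a) * f v <= f (a *: u + (1 - a) *: v)) ->
  differentiable f x -> f y <= f x + 'd f x (y - x).
Proof.
move=> cf df; pose v := y - x; have [v0|v0] := eqVneq v 0.
  by rewrite -/v v0 raddf0 addr0 -(subr0_eq v0).
have nv : 0 < `|v| by rewrite normr_gt0.
apply/ler_addgt0Pr => eps eps0.
have ev : 0 < eps / `|v| by exact: divr_gt0.
have /nbhs_ballP[d /= d0 hd] := differentiable_near df ev.
pose t := Num.min 1 (d / 2 / `|v|).
have t0 : 0 < t by rewrite lt_min ltr01 !divr_gt0.
have t1 : t <= 1 by rewrite ge_min lexx.
have /hd /= : ball 0 d (t *: v).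
  rewrite -ball_normE /ball_ /= sub0r normrN normrZ gtr0_norm //.
  apply: le_lt_trans (_ : _ <= d / 2) _; last by rewrite ltr_pdivrMr // ltr_pMr // ltr1n.
  by rewrite -ler_pdivlMr // ge_min lexx orbT.
have -> : 'd f x (t *: v) = t * 'd f x v by rewrite linearZ.
rewrite normrZ gtr0_norm // [eps / _ * _]mulrCA divfK ?gt_eqF // => h.
have h1 := le_trans (ler_norm _) h.
have := cf y x t; rewrite (ltW t0) t1 => /(_ isT).
have -> : t *: y + (1 - t) *: x = t *: v + x.
  by rewrite /v scalerBr scalerBl scale1r addrCA [RHS]addrC.
move=> h2; rewrite -(ler_pM2l t0) -/v; lra.
Qed.

Lemma diff_scale_arg (f : V -> R) (a b : R) (x v : V) : differentiable f (a *: x) ->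
  'd (b *: (f \o ( *:%R a))) x v = b * (a * 'd f (a *: x) v).
Proof.
move=> d1; have d2 : differentiable ( *:%R a : V -> V) x by [].
rewrite diffZ; last exact: differentiable_comp.
rewrite diff_comp //= diff_val.
congr (_ * _); exact: linearZ.
Qed.

End ConcaveGradient.

Section FhatGradients.
Variables (R : realType) (m n : nat) (p : mpoly.mpoly m R) (e : 'rV[R]_m).
Hypothesis n0 : (0 < n)%N.
Hypothesis hp : p \is mpoly.ishomog1 n (@mpoly.mdeg m).
Hypothesis hyp : hyperbolic p e.
Variables (ip : {dot 'rV[R]_m for idfun}) (L : set 'rV[R]_m) (W : {vspace 'rV[R]_m}).
Hypothesis LW : forall v, L v <-> v \in W.
Variable (L1 : R).
Hypothesis hL1 : lip_const p e ip L = L1%:E.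
Implicit Types (x y v : 'rV[R]_m) (mu : R).

Lemma fhat_le_grad mu x y : 0 < mu ->
  fhat p e mu y <= fhat p e mu x + ip (grad_fhat p e ip mu x) (y - x).
Proof.
move=> mu0; have df := differentiable_fhat n0 hp hyp x mu0.
rewrite -gradP //; apply: concave_le_diff df => u v a.
exact: (fhat_concave n0 hp hyp).
Qed.

Lemma grad_fhat_scale mu x : 0 < mu ->
  grad_fhat p e ip mu x = grad_fhat p e ip 1 (mu^-1 *: x).
Proof.
move=> mu0; apply: grad_unique; first exact: (differentiable_fhat n0 hp hyp).
move=> v; rewrite -gradP; last exact: (differentiable_fhat n0 hp hyp).
rewrite (_ : fhat p e mu = mu *: (fhat p e 1 \o ( *:%R mu^-1))); last first.
  by apply/funext => y; rewrite (fhat_scale hp hyp).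
have d1 := differentiable_fhat n0 hp hyp (mu^-1 *: x) ltr01.
have E := @diff_scale_arg R _ (fhat p e 1) mu^-1 mu x v d1.
by apply: etrans E _; rewrite mulVKf ?gt_eqF.
Qed.

Lemma pgrad_fhat_scale mu x : 0 < mu ->
  pgrad_fhat p e ip L mu x = pgrad_fhat p e ip L 1 (mu^-1 *: x).
Proof. by move=> mu0; rewrite /pgrad_fhat grad_fhat_scale. Qed.

Lemma pgrad_fhat_lipschitz mu x y : 0 < mu -> 0 < L1 -> L (y - x) ->
  let d := pgrad_fhat p e ip L mu y - pgrad_fhat p e ip L mu x in
  ip d d <= (L1 / mu) ^+ 2 * ip (y - x) (y - x).
Proof.
move=> mu0 L10 Lyx; have [->|yx] := eqVneq y x.
  by rewrite /= !subrr ip0l mulr0.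
rewrite (pgrad_fhat_scale x mu0) (pgrad_fhat_scale y mu0) /=; move: hL1; rewrite /lip_const.
move: (pgrad_fhat p e ip L 1) => P hP.
have v0 : mu^-1 *: (y - x) != 0.
  by rewrite scaler_eq0 invr_eq0 (gt_eqF mu0) subr_eq0.
have nv0 : 0 < ipnorm ip (mu^-1 *: (y - x)) by rewrite sqrtr_gt0 ip_gt0.
have : ((ipnorm ip (P (mu^-1 *: y) - P (mu^-1 *: x)) /
    ipnorm ip (mu^-1 *: (y - x)))%:E <= L1%:E)%E.
  rewrite -hP; apply: le_trans (ereal_sup_ubound _); last by exists (mu^-1 *: x).
  (* In the definition of L_1, the base point is x / mu and the two displacements are (y - x) / mu
     and 0. *)
  apply: ereal_sup_ubound; exists (mu^-1 *: (y - x), 0) => /=.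
    split=> //; apply/LW; first by rewrite rpredZ //; exact/LW.
    exact: rpred0.
  rewrite !addr0 subr0; congr (ipnorm ip (P _ - P _) / _)%:E.
  by rewrite scalerBr addrC subrK.
rewrite lee_fin ler_pdivrMr // => h.
have h2 := lerXn2r 2 (ipnorm_ge0 _ _) (mulr_ge0 (ltW L10) (ltW nv0)) h.
move: h2; rewrite exprMn !ipnorm_sqr ipZl ipZr => h2.
by apply: le_trans h2 _; rewrite exprMn !expr2 !mulrA.
Qed.

End FhatGradients.

(** * The accelerated method *)

Section Cocoercivity.
Variables (R : realType) (m : nat) (ip : {dot 'rV[R]_m for idfun}).
Variables (L : set 'rV[R]_m) (W : {vspace 'rV[R]_m}).
Hypothesis LW : forall v, L v <-> v \in W.
Implicit Types (x y v w : 'rV[R]_m) (F : 'rV[R]_m -> R) (G : 'rV[R]_m -> 'rV[R]_m).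

Lemma level0 : L 0. Proof. by apply/LW; rewrite rpred0. Qed.

Lemma levelD v w : L v -> L w -> L (v + w).
Proof. by move=> /LW hv /LW hw; apply/LW; rewrite rpredD. Qed.

Lemma levelZ (a : R) v : L v -> L (a *: v).
Proof. by move=> /LW hv; apply/LW; rewrite rpredZ. Qed.

Lemma levelN v : L v -> L (- v).
Proof. by move=> /LW hv; apply/LW; rewrite rpredN. Qed.

Lemma levelB v w : L v -> L w -> L (v - w).
Proof. by move=> hv hw; apply/levelD/levelN. Qed.

Lemma level_sub x y z : L (x - z) -> L (y - z) -> L (x - y).
Proof.
move=> hx hy; have -> : x - y = (x - z) - (y - z) by rewrite opprB addrA subrK.
exact: levelB.
Qed.

(* The lower bound F z >= F x + <G x, z - x> - l |z - x|^2 comes from concavity at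
   z; losing the usual factor 1/2 in it only doubles the final constant. *)
Lemma concave_cocoercive F G (l : R) : 0 < l -> (forall x, L (G x)) ->
  (forall x y, L (y - x) -> F y <= F x + ip (G x) (y - x)) ->
  (forall x y, L (y - x) ->
     ip (G y - G x) (G y - G x) <= l ^+ 2 * ip (y - x) (y - x)) ->
  forall x y, L (y - x) ->
    ip (G y - G x) (y - x) <= - (2 * l)^-1 * ip (G y - G x) (G y - G x).
Proof.
move=> l0 LG conc lip.
have lower x z : L (z - x) ->
    F x + ip (G x) (z - x) - l * ip (z - x) (z - x) <= F z.
  move=> Lzx; have Lxz : L (x - z) by rewrite -opprB; exact: levelN.
  have h1 := conc z x Lxz; have h2 := lip x z Lzx.
  (* This square stands in for the Cauchy-Schwarz inequality: with the Lipschitz bound it gives <G z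
     - G x, z - x> >= - l |z - x|^2. *)
  have h3 := ip_ge0 ip (G z - G x + l *: (z - x)).
  have h4 : ip (G z) (x - z) = - ip (G z - G x) (z - x) - ip (G x) (z - x).
    by rewrite -opprB !ipE; ring.
  have h5 : ip (G z - G x + l *: (z - x)) (G z - G x + l *: (z - x)) =
      ip (G z - G x) (G z - G x) + l * (2 * ip (G z - G x) (z - x)) +
      l ^+ 2 * ip (z - x) (z - x).
    move: (G z - G x) (z - x) => u w; rewrite !ipE (ipC ip w u); ring.
  rewrite h5 in h3; rewrite h4 in h1.
  have h6 : 0 <= l * (2 * ip (G z - G x) (z - x) + 2 * l * ip (z - x) (z - x)).
    by apply: le_trans h3 _; rewrite mulrDr; lra.
  rewrite pmulr_rge0 // in h6; lra.
have half x y : L (y - x) -> F y + (4 * l)^-1 * ip (G y - G x) (G y - G x) <=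
    F x + ip (G x) (y - x).
  (* Comparing both bounds at y + s d gains s |d|^2 - l s^2 |d|^2, which is largest, |d|^2 / (4 l),
     at this s. *)
  move=> Lyx; set d := G y - G x; pose s := (2 * l)^-1.
  have Ld : L (s *: d) by apply/levelZ/levelB.
  have h1 : L (y + s *: d - y) by rewrite addrC addKr.
  have h2 : L (y + s *: d - x) by rewrite addrAC; exact: levelD.
  have := conc x _ h2; have := lower y _ h1.
  rewrite [y + _ - y]addrC addKr [y + _ - x]addrAC.
  have -> : ip (G y) (s *: d) = s * ip (G x) d + s * ip d d.
    by rewrite -(subrK (G x) (G y)) -/d ipZr ipDl mulrDr addrC.
  rewrite [ip (s *: d) _]ipZr [ip (s *: d) d]ipZl.
  rewrite [ip (G x) (_ + s *: d)]ipDr [ip (G x) (s *: d)]ipZr.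
  have -> : l * (s * (s * ip d d)) = (4 * l)^-1 * ip d d.
    by rewrite /s; field; rewrite gt_eqF.
  have -> : s * ip d d = (4 * l)^-1 * ip d d + (4 * l)^-1 * ip d d.
    by rewrite /s; field; rewrite gt_eqF.
  lra.
move=> x y Lyx; have Lxy : L (x - y) by rewrite -opprB; exact: levelN.
have h1 := half x y Lyx; have h2 := half y x Lxy.
have -> : (2 * l)^-1 = (4 * l)^-1 + (4 * l)^-1 by field; rewrite gt_eqF.
have e1 : ip (G x - G y) (G x - G y) = ip (G y - G x) (G y - G x).
  by rewrite -opprB ipNl ipNr opprK.
have e2 : ip (G y) (x - y) = - ip (G y - G x) (y - x) - ip (G x) (y - x).
  by rewrite -opprB !ipE; ring.
rewrite e1 e2 in h2; lra.
Qed.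

End Cocoercivity.

Section AGM.
Variables (R : realType) (m : nat) (p : mpoly.mpoly m R) (e : 'rV[R]_m).
Variables (ip : {dot 'rV[R]_m for idfun}) (L : set 'rV[R]_m) (W : {vspace 'rV[R]_m}).
Hypothesis LW : forall v, L v <-> v \in W.
Variables (Lest mu ell : R) (K : nat) (F : 'rV[R]_m -> R).
Local Notation Gf := (grad_fhat p e ip mu).
Local Notation Gp := (pgrad_fhat p e ip L mu).
Hypothesis ell0 : 0 < ell.
Hypothesis LG : forall x, L (Gp x).
Hypothesis Gip : forall x w, L w -> ip (Gp x) w = ip (Gf x) w.
Hypothesis conc : forall x y, L (y - x) -> F y <= F x + ip (Gp x) (y - x).
Hypothesis coco : forall x y, L (y - x) ->
  ip (Gp y - Gp x) (y - x) <= - ell^-1 * ip (Gp y - Gp x) (Gp y - Gp x).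
Hypotheses (mu0 : 0 < mu) (Lest0 : 0 < Lest).
Hypotheses (K1 : Lest / mu <= ell * 2 ^+ K) (K2 : ell <= Lest / mu * 2 ^+ K).
Implicit Types (s : agm_state R m) (x v w : 'rV[R]_m).
Local Notation pass := (agm_pass p e ip L mu).

Definition agm_a s : R := (1 + Num.sqrt (1 + 2 * agm_A s * agm_L s)) / agm_L s.

Definition agm_y s : 'rV[R]_m := (agm_A s / (agm_A s + agm_a s)) *: agm_x s +
  (agm_a s / (agm_A s + agm_a s)) *: agm_v s.

Definition agm_next s : 'rV[R]_m := agm_y s + (agm_L s)^-1 *: Gp (agm_y s).

Lemma agm_passE s : pass s =
  if ip (Gf (agm_next s)) (agm_y s - agm_next s) >
     - (agm_L s)^-1 * ipnorm ip (Gp (agm_next s)) ^+ 2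
  then (AgmState (2 * agm_L s) (agm_v s) (agm_A s) (agm_x s), None)
  else (AgmState (agm_L s / 2) (agm_v s + agm_a s *: Gp (agm_next s))
          (agm_A s + agm_a s) (agm_next s), Some (agm_next s)).
Proof. by case: s. Qed.

Lemma agm_next_level s : L (agm_next s - agm_y s).
Proof. by rewrite addrC addKr; apply/(levelZ LW). Qed.

(** Write g_x, g_y for the projected gradients. Since x - y = g_y / L, cocoercivity with L >= ell
    gives <g_x - g_y, g_x> <= 0, that is |g_x|^2 <= <g_x, g_y>, which is the acceptance test. *)
Lemma agm_accept s : ell <= agm_L s -> ~~ (ip (Gf (agm_next s)) (agm_y s - agm_next s) >
     - (agm_L s)^-1 * ipnorm ip (Gp (agm_next s)) ^+ 2).
Proof.
move=> hL; rewrite -leNgt; have Ls0 : 0 < agm_L s by exact: lt_le_trans hL.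
have Ln := agm_next_level s; have := coco Ln.
set x := agm_next s; set y := agm_y s in Ln *.
have xyE : x - y = (agm_L s)^-1 *: Gp y by rewrite /x /agm_next addrC addKr.
have Lyx : L (y - x) by rewrite -opprB; exact: (levelN LW).
rewrite -Gip // ipnorm_sqr.
have -> : y - x = - (x - y) by rewrite opprB.
rewrite [ip (Gp x) (- _)]ipNr xyE !ipZr.
have le_inv : (agm_L s)^-1 <= ell^-1 by rewrite lef_pV2 ?posrE.
have dd := ip_ge0 ip (Gp x - Gp y).
move: (Gp x) (Gp y) dd => gx gy dd h.
have h2 : (agm_L s)^-1 * ip (gx - gy) gy <= - (agm_L s)^-1 * ip (gx - gy) (gx - gy).
  apply: le_trans h _; rewrite !mulNr lerN2; exact: ler_wpM2r.
rewrite mulNr -mulrN ler_pM2l ?invr_gt0 // in h2.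
rewrite mulNr lerN2 ler_pM2l ?invr_gt0 //.
move: h2; rewrite !ipE (ipC ip gy gx); lra.
Qed.

Lemma agm_a_gt0 s : 0 < agm_L s -> 0 < agm_a s.
Proof. by move=> h; rewrite divr_gt0 // ltr_pwDl // sqrtr_ge0. Qed.

(** The quadratic equation behind the choice of a: it balances the loss a^2 |g|^2 / 2 from moving v
    against the gain (A + a) |g|^2 / L from the acceptance test. *)
Lemma agm_a_root s : 0 < agm_L s -> 0 <= agm_A s ->
  agm_a s ^+ 2 / 2 = (agm_A s + agm_a s) / agm_L s.
Proof.
move=> L0 A0; rewrite /agm_a; set r := Num.sqrt _.
have r2 : r ^+ 2 = 1 + 2 * agm_A s * agm_L s.
  by rewrite sqr_sqrtr // addr_ge0 // !mulr_ge0 // ltW.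
have -> : agm_A s = (r ^+ 2 - 1) / (2 * agm_L s).
  by rewrite r2; field; rewrite gt_eqF.
by field; rewrite gt_eqF.
Qed.

(** The source of quadratic growth: while L is bounded, each accepted pass raises the square root of
    A by at least a fixed amount. *)
Lemma agm_sqrt_growth s : 0 < agm_L s -> 0 <= agm_A s ->
  Num.sqrt (agm_A s) + (Num.sqrt (2 * agm_L s))^-1 <= Num.sqrt (agm_A s + agm_a s).
Proof.
move=> L0 A0; have a0 := agm_a_gt0 L0.
pose w := Num.sqrt (2 * agm_L s); pose sA := Num.sqrt (agm_A s).
have w0 : 0 < w by rewrite sqrtr_gt0 mulr_gt0.
have w2 : w ^+ 2 = 2 * agm_L s by rewrite sqr_sqrtr // mulr_ge0 // ltW.
have sA0 : 0 <= sA by exact: sqrtr_ge0.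
have sA2 : sA ^+ 2 = agm_A s by exact: sqr_sqrtr.
rewrite -/w -/sA -[sA + w^-1]ger0_norm ?addr_ge0 ?invr_ge0 ?(ltW w0) //.
rewrite -sqrtr_sqr ler_wsqrtr // sqrrD sA2 -addrA lerD2l.
have hr : sA * w <= Num.sqrt (1 + 2 * agm_A s * agm_L s).
  rewrite -sqrtrM // ler_wsqrtr //; lra.
rewrite /agm_a; set r := Num.sqrt _ in hr *.
have -> : (1 + r) / agm_L s = (2 + 2 * r) * (w ^- 2).
  by rewrite w2; field; rewrite gt_eqF.
have -> : sA / w *+ 2 + w^-1 ^+ 2 = (2 * (sA * w) + 1) * w ^- 2.
  by field; rewrite gt_eqF.
rewrite ler_pM2r ?invr_gt0 ?exprn_gt0 //; lra.
Qed.

(* The invariant A f(x) - |x - x0|^2 / 2 <= psi(x) <= A f(x_k) - |x - v|^2 / 2 of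
   Nesterov's estimate functions psi, from which psi has been eliminated. *)
Definition agm_estimate x0 s := forall x, L (x - x0) ->
  agm_A s * F x - ip (x - x0) (x - x0) / 2 <=
  agm_A s * F (agm_x s) - ip (x - agm_v s) (x - agm_v s) / 2.

Lemma agm_y_level x0 s : 0 < agm_L s -> 0 <= agm_A s ->
  L (agm_v s - x0) -> L (agm_x s - x0) -> L (agm_y s - x0).
Proof.
move=> L0 A0 Lv Lx; have a0 := agm_a_gt0 L0.
rewrite (_ : agm_y s - x0 = (agm_A s / (agm_A s + agm_a s)) *: (agm_x s - x0) +
  (agm_a s / (agm_A s + agm_a s)) *: (agm_v s - x0)).
  by apply: (levelD LW); exact: (levelZ LW).
rewrite /agm_y !scalerBr addrACA -opprD -scalerDl -mulrDl divff ?scale1r //.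
by rewrite gt_eqF // ltr_wpDl.
Qed.

(** Concavity at the new point is applied towards x with weight a and towards x_k with weight A. The
    identity (A + a) y = A x_k + a v joins the two linear terms, and the test with [agm_a_root] pays
    for the square. *)
Lemma agm_estimate_step x0 s : 0 < agm_L s -> 0 <= agm_A s ->
  L (agm_v s - x0) -> L (agm_x s - x0) -> agm_estimate x0 s ->
  ip (Gf (agm_next s)) (agm_y s - agm_next s) <=
     - (agm_L s)^-1 * ipnorm ip (Gp (agm_next s)) ^+ 2 ->
  agm_estimate x0 (AgmState (agm_L s / 2) (agm_v s + agm_a s *: Gp (agm_next s))
          (agm_A s + agm_a s) (agm_next s)).
Proof.
move=> L0 A0 Lv Lx est acc x Lxx0 /=.
have a0 := agm_a_gt0 L0; have hr := agm_a_root L0 A0.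
have Ly := agm_y_level L0 A0 Lv Lx; have Ln := agm_next_level s.
have yE : (agm_A s + agm_a s) *: agm_y s = agm_A s *: agm_x s + agm_a s *: agm_v s.
  rewrite /agm_y scalerDr !scalerA ![_ * (_ / _)]mulrC !divfK //.
    by rewrite gt_eqF // ltr_wpDl.
  by rewrite gt_eqF // ltr_wpDl.
move: acc; rewrite ipnorm_sqr -Gip; last by rewrite -opprB; exact: (levelN LW).
set xn := agm_next s in Ln *; set y := agm_y s in Ly Ln yE *; set g := Gp xn => acc.
set A := agm_A s in A0 hr yE *; set a := agm_a s in a0 hr yE *.
have Lxn : L (xn - x0) by rewrite -(subrKA y); exact: (levelD LW).
have e0 := est x Lxx0.
have c1 := conc (level_sub LW Lxx0 Lxn); rewrite -/g in c1.
have c2 := conc (level_sub LW Lx Lxn); rewrite -/g in c2.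
have e1 : ip (x - (agm_v s + a *: g)) (x - (agm_v s + a *: g)) =
  ip (x - agm_v s) (x - agm_v s) - 2 * a * ip g (x - agm_v s) + a ^+ 2 * ip g g.
  by rewrite opprD addrA !ipE (ipC ip _ g) ?(ipC ip x g) ?(ipC ip (agm_v s) g)
    ?(ipC ip (agm_v s) x); ring.
have e2 : (A + a) * ip g (y - xn) =
   A * ip g (agm_x s - xn) + a * ip g (agm_v s - xn).
  have := congr1 (ip g) yE; rewrite !ipE => E.
  rewrite mulrDr E; ring.
have e3 : a * ip g (x - xn) = a * ip g (x - agm_v s) + a * ip g (agm_v s - xn).
  by rewrite !ipE; ring.
have m1 := ler_wpM2l A0 c2; have m2 := ler_wpM2l (ltW a0) c1.
have Aa0 : 0 <= A + a by rewrite addr_ge0 // ltW.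
have m3 := ler_wpM2l Aa0 acc.
have e4 : a ^+ 2 * ip g g / 2 = (A + a) * ((agm_L s)^-1 * ip g g).
  by rewrite mulrAC hr; ring.
rewrite -/A in e0; rewrite e1; lra.
Qed.

Definition agm_step (sl : agm_state R m * seq 'rV[R]_m) :=
  let: (s, o) := pass sl.1 in (s, sl.2 ++ seq_of_opt o).

Definition agm_run x0 (t : nat) := iter t agm_step (agm_init Lest mu x0, [::]).

Definition agm_bounds x0 s := [/\ 0 < agm_L s, 0 <= agm_A s,
  L (agm_v s - x0), L (agm_x s - x0) & agm_estimate x0 s].

(* [r] counts the rejected passes; L < 2 ell holds after the first rejection. *)
Definition agm_counts (t r : nat) s (l : seq 'rV[R]_m) :=
  [/\ t = (size l + r)%N, agm_L s = Lest / mu * 2 ^+ r / 2 ^+ size l,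
      (agm_L s < 2 * ell) || (r == 0)%N &
      (size l)%:R <= K%:R + 2 * Num.sqrt (ell * agm_A s)].

Lemma agm_bounds_step x0 s : agm_bounds x0 s ->
  agm_bounds x0 (pass s).1 /\ forall w, w \in seq_of_opt (pass s).2 -> L (w - x0).
Proof.
move=> [L0 A0 Lv Lx est]; rewrite agm_passE; have a0 := agm_a_gt0 L0.
have Ln : L (agm_next s - x0).
  rewrite -(subrKA (agm_y s)); apply: (levelD LW); first exact: agm_next_level.
  exact: agm_y_level.
case: ifPn => [_|/=]; first by split=> //; split=> //; rewrite /= mulr_gt0.
rewrite -leNgt => acc; split; last by move=> w; rewrite inE => /eqP ->.
split.
- by rewrite /= divr_gt0.
- by rewrite /= addr_ge0 // ltW.
- by rewrite /= addrAC; apply: (levelD LW) => //; exact: (levelZ LW).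
- exact: Ln.
- exact: agm_estimate_step.
Qed.

Lemma agm_counts_step t r s l : 0 < agm_L s -> 0 <= agm_A s -> agm_counts t r s l ->
  exists r', agm_counts t.+1 r' (pass s).1 (l ++ seq_of_opt (pass s).2).
Proof.
move=> L0 A0 [tE LE Lb sz]; rewrite agm_passE.
have a0 := agm_a_gt0 L0.
case: ifPn => [rej|_]; last first.
  exists r; rewrite /= cats1; split=> /=; rewrite ?size_rcons.
  - by rewrite tE.
  - by rewrite LE exprS invfM mulrA mulrAC.
  - case/orP: Lb => [h|->]; last by rewrite orbT.
    by apply/orP; left; lra.
  - have [lt|le] := ltnP (size l) K.
      apply: le_trans (_ : K%:R <= _); first by rewrite ler_nat.
      by rewrite lerDl mulr_ge0 ?sqrtr_ge0.
    have L2 : agm_L s <= 2 * ell.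
      case/orP: Lb => [/ltW //|/eqP r0].
      rewrite LE r0 expr0 mulr1 ler_pdivrMr ?exprn_gt0 //.
      apply: le_trans K1 _; rewrite -mulrA mulrCA; apply: ler_wpM2l; first exact: ltW.
      apply: le_trans (_ : 2 ^+ size l <= _); first by rewrite ler_eXn2l ?ltr1n.
      by rewrite ler_peMl ?exprn_ge0 // ler1n.
    have g := agm_sqrt_growth L0 A0.
    have s0 : 0 < Num.sqrt ell by rewrite sqrtr_gt0.
    rewrite sqrtrM ?(ltW ell0) // in sz; rewrite sqrtrM ?(ltW ell0) //.
    have := ler_wpM2l (ltW s0) g; rewrite mulrDr => g2.
    have : 2^-1 <= Num.sqrt ell * (Num.sqrt (2 * agm_L s))^-1.
      rewrite ler_pdivlMr ?sqrtr_gt0 ?mulr_gt0 // mulrC ler_pdivrMr //.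
      have -> : Num.sqrt ell * 2 = Num.sqrt (ell * 4).
        rewrite sqrtrM ?(ltW ell0) //; congr (_ * _).
        by rewrite (_ : 4 = 2 ^+ 2) ?sqrtr_sqr ?ger0_norm // expr2 -natrM.
      rewrite ler_wsqrtr //; lra.
    rewrite -[(size l).+1%:R]natr1; lra.
have Llt : agm_L s < ell.
  by rewrite ltNge; apply/negP => /agm_accept; rewrite rej.
exists r.+1; rewrite /= cats0; split=> //=; rewrite ?tE ?addnS //.
- by rewrite LE exprS; ring.
- by apply/orP; left; rewrite ltr_pM2l.
Qed.

Lemma agm_run_inv x0 t : let: (s, l) := agm_run x0 t in
  [/\ agm_bounds x0 s, exists r, agm_counts t r s l,
      forall w, w \in l -> L (w - x0) & (0 < size l)%N -> agm_x s \in l].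
Proof.
have L00 : L 0 := level0 LW.
elim: t => [|t] /=.
  split=> //=; last exists 0%N.
    split; rewrite /= ?divr_gt0 ?subrr // => x _ /=.
    by rewrite !mul0r.
  split=> //=; rewrite ?orbT ?expr0 ?divr1 ?mulr1 //.
  by rewrite mulr0 sqrtr0 mulr0 addr0 ler0n.
case: (agm_run x0 t) => s l [B [r Cr] Ll xl]; rewrite /agm_step /=.
have [B' Lo] := agm_bounds_step B.
have [L0 A0 _ _ _] := B; have [r' C'] := agm_counts_step L0 A0 Cr.
move: B' Lo C'; case E : (pass s) => [s' o] /= B' Lo C'.
split=> //; first by exists r'.
  by move=> w; rewrite mem_cat => /orP[/Ll|/Lo].
move: E; rewrite agm_passE; case: ifPn => _ [<- <-] /=; first by rewrite cats0.
by rewrite mem_cat inE eqxx orbT.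
Qed.

(** Rejected passes exceed accepted ones by at most K + 1, so t passes contain at least B + K
    accepted ones. Then B <= 2 sqrt (ell A), and the error |x - x0|^2 / (2 A) is at most 2 ell |x -
    x0|^2 / B^2 <= eta. *)
Lemma agm_converges x0 x (t : nat) (B eta : R) : L (x - x0) -> 0 < B ->
  2 * ell * ip (x - x0) (x - x0) <= eta * B ^+ 2 ->
  2 * B + 3 * K%:R + 1 <= t%:R ->
  exists2 xk, xk \in (agm_run x0 t).2 & F x - eta <= F xk.
Proof.
move=> Lx B0 hB ht; have := agm_run_inv x0 t.
case: (agm_run x0 t) => s l [[L0 A0 _ _ est] [r [tE LE Lb sz]] _ xl] /=.
(* After a rejection L < 2 ell <= 2 (Lest / mu) 2^K, while L = (Lest / mu) 2^(r - size l). *)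
have rle : (r <= size l + K + 1)%N.
  case/orP: Lb => [h|/eqP -> //].
  have : Lest / mu * 2 ^+ r < Lest / mu * 2 ^+ (size l + K + 1).
    rewrite LE ltr_pdivrMr ?exprn_gt0 // in h; apply: lt_le_trans h _.
    have -> : Lest / mu * 2 ^+ (size l + K + 1) =
        2 * (Lest / mu * 2 ^+ K) * 2 ^+ size l by rewrite !exprD expr1; ring.
    by rewrite ler_pM2r ?exprn_gt0 // ler_pM2l.
  rewrite ltr_pM2l ?divr_gt0 // ltr_eXn2l ?ltr1n //; exact: ltnW.
have szB : B <= (size l)%:R - K%:R.
  have : (t%:R : R) <= (size l + size l + K + 1)%:R.
    by rewrite ler_nat tE -!addnA leq_add2l addnA.
  rewrite !natrD; lra.
have B2 : B <= 2 * Num.sqrt (ell * agm_A s) by lra.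
have B4 : B ^+ 2 <= 4 * (ell * agm_A s).
  have := lerXn2r 2 (ltW B0) (le_trans (ltW B0) B2) B2.
  by rewrite exprMn sqr_sqrtr ?mulr_ge0 ?(ltW ell0) // -natrX.
have As0 : 0 < agm_A s.
  have : 0 < 4 * (ell * agm_A s) by apply: lt_le_trans B4; rewrite exprn_gt0.
  by rewrite !pmulr_rgt0.
have sz0 : (0 < size l)%N.
  by rewrite -(ltr_nat R); have := ler0n R K; lra.
exists (agm_x s); first exact: xl.
have := est x Lx; have := ip_ge0 ip (x - agm_v s); move: (ip (x - agm_v s) _) => q q0 h.
have eta0 : 0 <= eta.
  rewrite -(pmulr_lge0 _ (exprn_gt0 2 B0)); apply: le_trans hB.
  by rewrite !mulr_ge0 ?ip_ge0 // ltW.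
have h3 : 2 * ell * ip (x - x0) (x - x0) <= 2 * ell * (2 * agm_A s * eta).
  by apply: le_trans hB _; have := ler_wpM2l eta0 B4; lra.
rewrite ler_pM2l ?mulr_gt0 // in h3.
have : agm_A s * (F x - eta) <= agm_A s * F (agm_x s) by lra.
by rewrite ler_pM2l.
Qed.

End AGM.

(** * Logarithmic bounds on the numbers of line-search corrections and restarts *)

Section RealBounds.
Variable R : realType.
Implicit Types (x r : R).

Lemma expR_half_le2 : expR (2^-1 : R) <= 2.
Proof.
have h := expR_ge1Dx (- 2^-1 : R); rewrite expRN in h.
rewrite -[leLHS]invrK -[leRHS]invrK lef_pV2 ?posrE ?invr_gt0 ?expR_gt0 //; lra.
Qed.

Lemma expR_third_le : expR (3^-1 : R) <= 3 / 2.
Proof.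
have h := expR_ge1Dx (- 3^-1 : R); rewrite expRN in h.
rewrite -[leLHS]invrK -[leRHS]invrK lef_pV2 ?posrE ?invr_gt0 ?expR_gt0 ?divr_gt0 //.
rewrite invf_div; lra.
Qed.

Lemma expR_le_expn (b y x : R) (k : nat) : expR y <= b -> x <= k%:R * y ->
  expR x <= b ^+ k.
Proof.
move=> hb hx; apply: (@le_trans _ _ (expR (k%:R * y))); first by rewrite ler_expR.
by rewrite expRM_natl lerXn2r ?nnegrE ?expR_ge0 // (le_trans _ hb) ?expR_ge0.
Qed.

Lemma nat_above x : 0 <= x -> exists k : nat, x <= k%:R /\ k%:R <= x + 1.
Proof.
move=> x0; exists (Num.truncn x).+1; have /andP[h1 h2] := truncn_itv x0.
by split; [exact: ltW|rewrite -natr1 lerD2r].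
Qed.

(** Bounds the doublings or halvings separating the estimate a of the Lipschitz constant from 2 b.
    The inequality exp (1/2) <= 2 trades base 2 for the natural logarithm, and one more doubling
    absorbs the factor 2. *)
Lemma log2_ratio_exponent (a b : R) : 0 < a -> 0 < b -> exists K : nat,
  [/\ a <= 2 * b * 2 ^+ K, 2 * b <= a * 2 ^+ K & K%:R <= 2 + 2 * `|ln (a / b)|].
Proof.
move=> a0 b0; set l := `|ln (a / b)|.
have l0 : 0 <= l by exact: normr_ge0.
have [k [k1 k2]] := nat_above (mulr_ge0 (ler0n R 2) l0).
have ek : expR l <= 2 ^+ k by apply: expR_le_expn expR_half_le2 _; lra.
have h1 : a / b <= 2 ^+ k.
  by apply: le_trans ek; rewrite -[leLHS]lnK ?posrE ?divr_gt0 // ler_expR ler_norm.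
have h2 : b / a <= 2 ^+ k.
  apply: le_trans ek; rewrite -[leLHS]lnK ?posrE ?divr_gt0 // ler_expR.
  by rewrite -[b / a]invf_div lnV ?posrE ?divr_gt0 // /l -normrN ler_norm.
exists k.+1; rewrite ler_pdivrMr // in h1; rewrite ler_pdivrMr // in h2; split.
- rewrite exprS; have : 0 <= 2 ^+ k * b by rewrite mulr_ge0 ?exprn_ge0 // ltW.
  lra.
- rewrite exprS; lra.
- rewrite -[k.+1%:R]natr1; lra.
Qed.

(** Here 3/2 is the guaranteed growth per restart, and exp (1/3) <= 3/2 gives the factor 3. *)
Lemma growth_exponent r : 1 <= r -> exists k : nat,
  r <= (3 / 2) ^+ k /\ k%:R <= 1 + 3 * ln r.
Proof.
move=> r1; have r0 : 0 < r by lra.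
have [k [k1 k2]] := nat_above (mulr_ge0 (ler0n R 3) (ln_ge0 r1)).
exists k; split; last by lra.
by rewrite -[leLHS]lnK ?posrE //; apply: expR_le_expn expR_third_le _; lra.
Qed.

End RealBounds.

Section FhatAGM.
Variables (R : realType) (m n : nat) (p : mpoly.mpoly m R) (e : 'rV[R]_m).
Hypothesis n0 : (0 < n)%N.
Hypothesis hp : p \is mpoly.ishomog1 n (@mpoly.mdeg m).
Hypothesis hyp : hyperbolic p e.
Variables (ip : {dot 'rV[R]_m for idfun}) (L : set 'rV[R]_m) (W : {vspace 'rV[R]_m}).
Hypothesis LW : forall v, L v <-> v \in W.
Variables (L1 Lest mu : R) (K : nat).
Hypotheses (hL1 : lip_const p e ip L = L1%:E) (L10 : 0 < L1).
Hypotheses (mu0 : 0 < mu) (Lest0 : 0 < Lest).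
Hypotheses (K1 : Lest <= 2 * L1 * 2 ^+ K) (K2 : 2 * L1 <= Lest * 2 ^+ K).

(** L1 / mu is the Lipschitz constant of the projected gradient; the factor 2 is the one lost in
    [concave_cocoercive]. *)
Let ell := 2 * (L1 / mu).
Let ell0 : 0 < ell. Proof. by rewrite mulr_gt0 // divr_gt0. Qed.

Let LG x : L (pgrad_fhat p e ip L mu x).
Proof. by have [] := ortho_projP ip LW (grad_fhat p e ip mu x). Qed.

Let Gip x w : L w -> ip (pgrad_fhat p e ip L mu x) w = ip (grad_fhat p e ip mu x) w.
Proof. by have [_] := ortho_projP ip LW (grad_fhat p e ip mu x); apply. Qed.

Let conc x y : L (y - x) ->
  fhat p e mu y <= fhat p e mu x + ip (pgrad_fhat p e ip L mu x) (y - x).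
Proof. by move=> h; rewrite Gip //; apply: (fhat_le_grad n0 hp hyp). Qed.

Let coco x y : L (y - x) ->
  ip (pgrad_fhat p e ip L mu y - pgrad_fhat p e ip L mu x) (y - x) <=
  - ell^-1 * ip (pgrad_fhat p e ip L mu y - pgrad_fhat p e ip L mu x)
                (pgrad_fhat p e ip L mu y - pgrad_fhat p e ip L mu x).
Proof.
apply: (concave_cocoercive LW (F := fhat p e mu) (divr_gt0 L10 mu0) LG conc).
by move=> u v Luv; exact: (pgrad_fhat_lipschitz n0 hp hyp LW hL1 mu0 L10).
Qed.

Let K1' : Lest / mu <= ell * 2 ^+ K.
Proof.
have -> : ell * 2 ^+ K = 2 * L1 * 2 ^+ K / mu by rewrite /ell; ring.
by rewrite ler_pM2r ?invr_gt0.
Qed.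

Let K2' : ell <= Lest / mu * 2 ^+ K.
Proof.
have -> : Lest / mu * 2 ^+ K = Lest * 2 ^+ K / mu by ring.
by rewrite /ell mulrA ler_pM2r ?invr_gt0.
Qed.

Lemma fhat_agm_converges x0 x (t : nat) (B eta : R) : L (x - x0) -> 0 < B ->
  4 * (L1 / mu) * ip (x - x0) (x - x0) <= eta * B ^+ 2 ->
  2 * B + 3 * K%:R + 1 <= t%:R ->
  exists2 xk, xk \in (agm_run p e ip L Lest mu x0 t).2 &
    fhat p e mu x - eta <= fhat p e mu xk.
Proof.
move=> Lx B0 h; apply: (agm_converges LW ell0 LG Gip conc coco mu0 Lest0 K1' K2' Lx B0).
by apply: le_trans h; rewrite /ell; lra.
Qed.

Lemma fhat_agm_level x0 t w : w \in (agm_run p e ip L Lest mu x0 t).2 -> L (w - x0).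
Proof.
have := agm_run_inv LW ell0 LG Gip conc coco mu0 Lest0 K1' x0 t.
by case: (agm_run _ _ _ _ _ _ _ _) => s l [_ _ h _] /h.
Qed.

End FhatAGM.

(** * The main algorithm *)

Section LockstepRestarts.
Variables (R : realType) (m : nat) (p : mpoly.mpoly m R) (e : 'rV[R]_m).
Variables (ip : {dot 'rV[R]_m for idfun}) (L : set 'rV[R]_m) (Lest nu1 nu2 : R).
Variables (stp : main_state R m -> main_state R m) (good : pred 'rV[R]_m).
Variable (restart : 'rV[R]_m -> 'rV[R]_m).
Local Notation run nu := (agm_run p e ip L Lest nu).
Local Notation start v :=
  (MainState (agm_init Lest nu1 v) (agm_init Lest nu2 v)).
Hypothesis stpE : forall a1 a2 ws xs g s1 o1 s2 o2,
  agm_pass p e ip L nu1 a1 = (s1, o1) -> agm_pass p e ip L nu2 a2 = (s2, o2) ->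
  stp (MainState a1 a2 ws xs g) =
  if o1 is Some w then
    if good w then start (restart w) (ws ++ seq_of_opt o1) (xs ++ seq_of_opt o2) (g + 4)
    else MainState s1 s2 (ws ++ seq_of_opt o1) (xs ++ seq_of_opt o2) (g + 4)
  else MainState s1 s2 (ws ++ seq_of_opt o1) (xs ++ seq_of_opt o2) (g + 4).

Lemma agm_runS nu v T s o : agm_pass p e ip L nu (run nu v T).1 = (s, o) ->
  run nu v T.+1 = (s, (run nu v T).2 ++ seq_of_opt o).
Proof. by rewrite /agm_run iterS /agm_step => ->. Qed.

(** Until the first restart the lockstep run is a pair of independent runs from v, to which the
    convergence of a single run applies; a restart yields again a starting state, with longer
    histories only. *)
Lemma lockstep_phase v ws xs g T :
  (iter T stp (start v ws xs g) =
     MainState (run nu1 v T).1 (run nu2 v T).1 (ws ++ (run nu1 v T).2)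
       (xs ++ (run nu2 v T).2) (g + 4 * T) /\
   forall w, w \in (run nu1 v T).2 -> ~~ good w) \/
  exists2 t, (t <= T)%N & exists w ws' xs' g', [/\ w \in (run nu1 v t).2, good w &
    iter t stp (start v ws xs g) = start (restart w) ws' xs' g'].
Proof.
elim: T => [|T [[IH1 IH2]|[t tT ht]]]; last by right; exists t; rewrite ?(leqW tT).
  by left; rewrite /= !cats0 muln0 addn0.
have gE : (g + 4 * T + 4 = g + 4 * T.+1)%N by rewrite mulnS; lia.
have R1 s o := @agm_runS nu1 v T s o; have R2 s o := @agm_runS nu2 v T s o.
have H : iter T.+1 stp (start v ws xs g) = _ := etrans (iterS _ _ _) (congr1 stp IH1).
suff [h|h] : (iter T.+1 stp (start v ws xs g) =
     MainState (run nu1 v T.+1).1 (run nu2 v T.+1).1 (ws ++ (run nu1 v T.+1).2)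
       (xs ++ (run nu2 v T.+1).2) (g + 4 * T.+1) /\
   forall w, w \in (run nu1 v T.+1).2 -> ~~ good w) \/
  exists w ws' xs' g', [/\ w \in (run nu1 v T.+1).2, good w &
    iter T.+1 stp (start v ws xs g) = start (restart w) ws' xs' g'].
- by left.
- by right; exists T.+1.
move: (iter T.+1 _ _) (run nu1 v T.+1) (run nu2 v T.+1) H R1 R2 IH2 {IH1}.
case: (run nu1 v T) (run nu2 v T) => [a1 l1] [a2 l2] /= X r1 r2 -> R1 R2 IH2.
case E1 : (agm_pass p e ip L nu1 a1) => [s1 o1].
case E2 : (agm_pass p e ip L nu2 a2) => [s2 o2].
rewrite (R1 _ _ E1) (R2 _ _ E2) (stpE _ _ _ E1 E2) gE /= -!catA.
case: o1 E1 => [w|] E1; last by left; rewrite cats0.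
case: ifPn => gw; [right|left].
  by do 4!eexists; split; last reflexivity; rewrite // mem_cat inE eqxx orbT.
split=> // w'.
by rewrite mem_cat inE => /orP[/IH2 //|/eqP ->].
Qed.

End LockstepRestarts.

Section MainLoop.
Variables (R : realType) (m n : nat) (p : mpoly.mpoly m R) (e : 'rV[R]_m).
Variables (ip : {dot 'rV[R]_m for idfun}) (L : set 'rV[R]_m) (Lest eps : R).
Local Notation step := (main_step n p e ip L Lest eps).
Local Notation run1 := (agm_run p e ip L Lest (mu1 R n)).
Local Notation run2 := (agm_run p e ip L Lest (mu2 n eps)).
Local Notation good w := (1 / 2 <= lambda_min p e w).
Implicit Types (v w : 'rV[R]_m) (ws xs : seq 'rV[R]_m) (g t : nat).

Definition main_start v ws xs g : main_state R m :=
  MainState (agm_init Lest (mu1 R n) v) (agm_init Lest (mu2 n eps) v) ws xs g.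

Lemma main_grads_iter t s :
  main_grads (iter t step s) = (main_grads s + 4 * t)%N.
Proof.
elim: t => [|t IH] /=; first by rewrite muln0 addn0.
rewrite [LHS](_ : _ = main_grads (iter t step s) + 4)%N; last first.
  rewrite /main_step; case: (agm_pass _ _ _ _ _ _) => s1 o1.
  by case: (agm_pass _ _ _ _ _ _) => s2 o2; case: o1 => //= w; case: ifP.
by rewrite IH mulnS; lia.
Qed.

Lemma main_stepE a1 a2 ws xs g s1 o1 s2 o2 :
  agm_pass p e ip L (mu1 R n) a1 = (s1, o1) ->
  agm_pass p e ip L (mu2 n eps) a2 = (s2, o2) ->
  step (MainState a1 a2 ws xs g) =
  if o1 is Some w then
    if good w then main_start (restart_point p e w) (ws ++ seq_of_opt o1)
      (xs ++ seq_of_opt o2) (g + 4)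
    else MainState s1 s2 (ws ++ seq_of_opt o1) (xs ++ seq_of_opt o2) (g + 4)
  else MainState s1 s2 (ws ++ seq_of_opt o1) (xs ++ seq_of_opt o2) (g + 4).
Proof. by rewrite /main_step /= => -> ->; case: o1. Qed.

Lemma main_run_phase v ws xs g T :
  (iter T step (main_start v ws xs g) =
     MainState (run1 v T).1 (run2 v T).1 (ws ++ (run1 v T).2) (xs ++ (run2 v T).2)
       (g + 4 * T) /\ forall w, w \in (run1 v T).2 -> ~~ good w) \/
  exists2 t, (t <= T)%N & exists w ws' xs' g', [/\ w \in (run1 v t).2, good w &
    iter t step (main_start v ws xs g) = main_start (restart_point p e w) ws' xs' g'].
Proof. exact: (lockstep_phase main_stepE). Qed.

End MainLoop.

(** * Progress between restarts and their number *)

Section MainAlgorithm.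
Variables (R : realType) (m n : nat) (p : mpoly.mpoly m R) (K : set 'rV[R]_m).
Variables (dot ip : {dot 'rV[R]_m for idfun}) (c : 'rV[R]_m).
Variables (Affine : set 'rV[R]_m) (D : {vspace 'rV[R]_m}) (zstar : R).
Variables (e : 'rV[R]_m) (L1 eps Lest : R).
Let L := level_space dot c D.
Hypothesis n2 : (2 <= n)%N.
Hypothesis hK : hyperbolicity_cone p n K.
Hypothesis hA : is_translate Affine D.
Hypothesis hopt : optimal_value dot c Affine K zstar.
Hypotheses (Ae : Affine e) (Ke : K° e).
Hypotheses (hL1 : lip_const p e ip L = L1%:E) (L10 : 0 < L1).
Hypotheses (eps01 : 0 < eps < 1) (Lest0 : 0 < Lest).
Hypothesis zce : zstar < dot c e.
Implicit Types (x v w : 'rV[R]_m) (s t : R).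
Local Notation lmin := (lambda_min p e).

Let n0 : (0 < n)%N. Proof. exact: ltnW. Qed.
Let hp := cone_homog hK.
Let hyp := cone_hyperbolic hK Ke.
Let eps0 : 0 < eps. Proof. by case/andP: eps01. Qed.
Let gap0 : 0 < dot c e - zstar. Proof. by rewrite subr_gt0. Qed.

Lemma affine_sub x y : Affine x -> Affine y -> x - y \in D.
Proof.
have [a ->] := hA => /= xa ya.
have -> : x - y = (x - a) - (y - a) by rewrite opprB addrA subrK.
by rewrite rpredB.
Qed.

Lemma affine_add x d : Affine x -> d \in D -> Affine (x + d).
Proof. by have [a ->] := hA => /= xa dD; rewrite addrAC rpredD. Qed.

Lemma affine_ray x s : Affine x -> Affine (e + s *: (x - e)).
Proof. by move=> Ax; apply/affine_add => //; apply/rpredZ/affine_sub. Qed.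

Lemma dot_ray x s : dot c (e + s *: (x - e)) = dot c e - s * (dot c e - dot c x).
Proof. by rewrite !ipE; ring. Qed.

Lemma level_affine x v : Affine v -> L (x - v) -> Affine x /\ dot c x = dot c v.
Proof.
move=> Av [xvD xv]; split; last by move: xv; rewrite ipDr ipNr => /subr0_eq.
by have := affine_add Av xvD; rewrite addrC subrK.
Qed.

Lemma affine_level x v : Affine x -> Affine v -> dot c x = dot c v -> L (x - v).
Proof.
move=> Ax Av xv; split; first exact: affine_sub.
by rewrite ipDr ipNr xv subrr.
Qed.

(* The largest lambda_min on the slice [dot c x = z] is 1 - slack x. *)
Definition slack x : R := (dot c e - dot c x) / (dot c e - zstar).

Lemma slack_gt0 x : dot c x < dot c e -> 0 < slack x.
Proof. by move=> h; rewrite divr_gt0 // subr_gt0. Qed.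

(** Follow the ray from e through x to the point where [lambda_min] is 0: it is feasible, so its
    value is at least zstar. *)
Lemma slack_le x : Affine x -> dot c x < dot c e -> slack x <= 1 - lmin x.
Proof.
move=> Ax xce; have gx : 0 < dot c e - dot c x by rewrite subr_gt0.
have low t : 0 <= t -> 0 <= 1 - t * (1 - lmin x) ->
    t * (dot c e - dot c x) <= dot c e - zstar.
  move=> t0 h; have Kt : K (e + t *: (x - e)).
    by apply: (lambda_min_ge0_cone hK n0 Ke); rewrite (lambda_min_ray hK n0 Ke).
  by have := hopt.2 _ (affine_ray t Ax) Kt; rewrite dot_ray; lra.
have [u0|u0] := leP (1 - lmin x) 0.
  (* If [lambda_min] of x were at least 1, the whole ray would be feasible; at this t the objective
     is already zstar - 1. *)
  pose t := (dot c e - zstar + 1) / (dot c e - dot c x).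
  have t0 : 0 <= t by rewrite ltW // divr_gt0 // addr_gt0.
  have tu : t * (1 - lmin x) <= 0 by rewrite mulr_ge0_le0.
  have := low t t0; rewrite [t * (dot c e - _)]divfK ?gt_eqF // => h.
  by have := h (_ : 0 <= 1 - t * (1 - lmin x)); lra.
have := low (1 - lmin x)^-1; rewrite invr_ge0 (ltW u0) mulVf ?gt_eqF // subrr lexx.
by move=> /(_ isT isT); rewrite ler_pdivrMr // mulrC ler_pdivrMr // mulrC.
Qed.

Lemma radial_gap x : Affine x -> dot c x < dot c e ->
  (dot c (radial_proj p e x) - zstar) / (dot c e - zstar) =
  (1 - slack x - lmin x) / (1 - lmin x).
Proof.
move=> Ax xce; have u0 := lt_le_trans (slack_gt0 xce) (slack_le Ax xce).
rewrite /radial_proj dot_ray /slack; field.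
by rewrite !gt_eqF.
Qed.

Definition opt_point : 'rV[R]_m := xget 0 [set x | [/\ Affine x, K x & dot c x = zstar]].

Lemma opt_pointP : [/\ Affine opt_point, K opt_point & dot c opt_point = zstar].
Proof. by have [ex _] := hopt; exact: (xgetPex 0 ex). Qed.

(** Where the line from e to an optimal solution meets the slice of v. It is the point against which
    both methods are compared. *)
Definition slice_opt v : 'rV[R]_m := e + slack v *: (opt_point - e).

Definition admissible v := [/\ Affine v, dot c v < dot c e & lmin v = 1 / 4].

Lemma slice_opt_level v : admissible v -> L (slice_opt v - v).
Proof.
move=> [Av vce _]; have [Ao _ co] := opt_pointP.
apply: affine_level => //; first exact: affine_ray.
by rewrite dot_ray co /slack divfK ?gt_eqF //; ring.
Qed.

Lemma slice_opt_lmin v : admissible v -> 1 - slack v <= lmin (slice_opt v).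
Proof.
move=> [Av vce _]; have [_ Ko _] := opt_pointP.
have s0 := ltW (slack_gt0 vce).
rewrite (lambda_min_ray hK n0 Ke) //.
have := cone_lambda_min_ge0 hK n0 Ke Ko => h.
by rewrite lerD2l lerN2 ler_piMr // gerBl.
Qed.

Lemma slack_admissible v : admissible v -> slack v <= 3 / 4.
Proof. by move=> [Av vce l4]; have := slack_le Av vce; rewrite l4; lra. Qed.

Lemma diam_ge v (z1 : R) : admissible v -> dot c v <= z1 ->
  ((ipnorm ip (slice_opt v - v))%:E <= Diam dot c Affine K ip z1)%E.
Proof.
move=> av vz1; have [Av vce lv] := av.
have [As cs] := level_affine Av (slice_opt_level av).
apply: (@le_trans _ _ (diam dot c Affine K ip (dot c v))).
  apply: ereal_sup_ubound; exists (slice_opt v, v) => //; split=> /=; split=> //.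
    apply: (lambda_min_ge0_cone hK n0 Ke); apply: le_trans (slice_opt_lmin av).
    by have := slack_admissible av; lra.
  by apply: (lambda_min_ge0_cone hK n0 Ke); rewrite lv; lra.
by apply: ereal_sup_ubound; exists (dot c v).
Qed.

(** The distance of w to e is scaled by t = (3/4) / (1 - lmin w) >= 3/2: this brings [lambda_min] to
    exactly 1/4 and multiplies the slack by t. *)
Lemma restart_admissible v w : admissible v -> L (w - v) -> 1 / 2 <= lmin w ->
  [/\ admissible (restart_point p e w), dot c (restart_point p e w) <= dot c v &
      3 / 2 * slack v <= slack (restart_point p e w)].
Proof.
move=> [Av vce _] Lw lw; have [Aw cw] := level_affine Av Lw.
have wce : dot c w < dot c e by rewrite cw.
have u0 := lt_le_trans (slack_gt0 wce) (slack_le Aw wce).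
pose t := 3 / 4 * (1 - lmin w)^-1.
have t32 : 3 / 2 <= t by rewrite /t ler_pdivlMr //; lra.
have t0 : 0 <= t by lra.
have gw : 0 < dot c e - dot c v by rewrite subr_gt0.
have tg : 3 / 2 * (dot c e - dot c v) <= t * (dot c e - dot c v) by rewrite ler_pM2r.
have cE : dot c (restart_point p e w) = dot c e - t * (dot c e - dot c v).
  by rewrite /restart_point dot_ray cw.
split; first split.
- exact: affine_ray.
- rewrite cE; lra.
- rewrite /restart_point (lambda_min_ray hK n0 Ke) // -/t /t divfK ?gt_eqF //; lra.
- rewrite cE; lra.
- rewrite /slack cE mulrA ler_pM2r ?invr_gt0 //; lra.
Qed.

Definition success (st : main_state R m) := exists2 xk, xk \in main_iters2 st &
  (dot c (radial_proj p e xk) - zstar) / (dot c e - zstar) <= eps.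

Let lnn0 : 0 < ln (n%:R : R). Proof. by rewrite ln_gt0 // ltr1n. Qed.
Let mu10 : 0 < mu1 R n. Proof. by rewrite divr_gt0 // mulr_gt0. Qed.
Let mu20 : 0 < mu2 n eps. Proof. by rewrite divr_gt0 // mulr_gt0. Qed.
Let sigma := Num.sqrt (L1 * ln n%:R).
Let sigma0 : 0 <= sigma. Proof. exact: sqrtr_ge0. Qed.
Let sigma2 : sigma ^+ 2 = L1 * ln n%:R.
Proof. by rewrite sqr_sqrtr // mulr_ge0 // ltW. Qed.

Variable kap : nat.
Hypotheses (K1 : Lest <= 2 * L1 * 2 ^+ kap) (K2 : 2 * L1 <= Lest * 2 ^+ kap).

(** The count 2 B + 3 kap + 1 of [agm_converges] with B = 24 delta sigma + 1, plus 1 for rounding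
    up; [success_time] arises likewise from B = 12 delta sigma / eps + 1. *)
Definition restart_time (delta : R) : R := 48 * (delta * sigma) + 4 + 3 * kap%:R.

Definition success_time (delta : R) : R := 24 * (delta * sigma / eps) + 4 + 3 * kap%:R.

Local Notation step := (main_step n p e ip L Lest eps).
Local Notation start := (main_start n Lest eps).

Definition restarted v st := exists v' ws xs g, [/\ admissible v', dot c v' <= dot c v,
  3 / 2 * slack v <= slack v' & st = start v' ws xs g].

Let LWex := level_space_vspace dot c D.

Lemma phase_outcome v ws xs g (T : nat) : admissible v ->
  (exists2 t, (t <= T)%N & restarted v (iter t step (start v ws xs g))) \/
  (iter T step (start v ws xs g) =
     MainState (agm_run p e ip L Lest (mu1 R n) v T).1
       (agm_run p e ip L Lest (mu2 n eps) v T).1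
       (ws ++ (agm_run p e ip L Lest (mu1 R n) v T).2)
       (xs ++ (agm_run p e ip L Lest (mu2 n eps) v T).2) (g + 4 * T) /\
   forall w, w \in (agm_run p e ip L Lest (mu1 R n) v T).2 -> ~~ (1 / 2 <= lmin w)).
Proof.
move=> av; have [W LW] := LWex.
have [h|[t tT [w [ws' [xs' [g' [wt lw stE]]]]]]] :=
  main_run_phase n p e ip L Lest eps v ws xs g T; first by right.
left; exists t => //.
have Lw := fhat_agm_level n0 hp hyp LW hL1 L10 mu10 Lest0 K1 wt.
have [a1 a2 a3] := restart_admissible av Lw lw.
by exists (restart_point p e w), ws', xs', g'.
Qed.

Lemma phase_restarts v (delta : R) ws xs g (T : nat) : admissible v ->
  slack v <= 1 / 3 -> 0 <= delta -> ipnorm ip (slice_opt v - v) <= delta ->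
  48 * (delta * sigma) + 3 + 3 * kap%:R <= T%:R ->
  exists2 t, (t <= T)%N & restarted v (iter t step (start v ws xs g)).
Proof.
move=> av sv d0 hd hT; have [//|[_ no]] := phase_outcome ws xs g T av.
have [W LW] := LWex; exfalso.
have Lx := slice_opt_level av.
have ds0 : 0 <= delta * sigma by exact: mulr_ge0.
(* As L1 / mu_1 = 12 sigma^2, an error of 1/12 requires B^2 >= 576 (delta sigma)^2; adding 1 keeps B
   positive. *)
pose B := 24 * (delta * sigma) + 1.
have B0 : 0 < B by rewrite ltr_wpDl // mulr_ge0.
have hip : 4 * (L1 / mu1 R n) * ip (slice_opt v - v) (slice_opt v - v) <=
    1 / 12 * B ^+ 2.
  rewrite -ipnorm_sqr (_ : L1 / mu1 R n = 12 * sigma ^+ 2); last first.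
    by rewrite sigma2 /mu1; field; rewrite gt_eqF.
  have h1 : ipnorm ip (slice_opt v - v) ^+ 2 <= delta ^+ 2.
    by rewrite lerXn2r ?nnegrE ?ipnorm_ge0.
  have h2 := ler_wpM2l (sqr_ge0 sigma) h1.
  rewrite /B; have : sigma ^+ 2 * delta ^+ 2 = (delta * sigma) ^+ 2 by ring.
  move: (delta * sigma) ds0 h2 => X X0 h2 E; rewrite E in h2; nra.
have hTB : 2 * B + 3 * kap%:R + 1 <= T%:R by rewrite /B; lra.
have [xk xkT hx] := fhat_agm_converges n0 hp hyp LW hL1 L10 mu10 Lest0 K1 K2 Lx B0 hip hTB.
have := no xk xkT; rewrite -ltNge.
have f1 := fhat_ge_lambda_min n0 hp hyp (slice_opt v) mu10.
have f2 := fhat_le_lambda_min n0 hp hyp xk mu10.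
have f3 := slice_opt_lmin av.
have f4 : mu1 R n * ln n%:R = 1 / 12 by rewrite /mu1; field; rewrite gt_eqF.
lra.
Qed.

Lemma phase_succeeds v (delta : R) ws xs g (T : nat) : admissible v ->
  1 / 3 < slack v -> 0 <= delta -> ipnorm ip (slice_opt v - v) <= delta ->
  24 * (delta * sigma / eps) + 3 + 3 * kap%:R <= T%:R ->
  (exists2 t, (t <= T)%N & restarted v (iter t step (start v ws xs g))) \/
  success (iter T step (start v ws xs g)).
Proof.
move=> av sv d0 hd hT; have [|[-> _]] := phase_outcome ws xs g T av; [by left|right].
have [W LW] := LWex.
have Lx := slice_opt_level av.
have ds0 : 0 <= delta * sigma / eps by rewrite divr_ge0 ?mulr_ge0 // ltW.
(* As L1 / mu_2 = 6 sigma^2 / eps, an error of eps/6 requires B^2 >= 144 (delta sigma / eps)^2. *)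
pose B := 12 * (delta * sigma / eps) + 1.
have B0 : 0 < B by rewrite ltr_wpDl // mulr_ge0.
have hip : 4 * (L1 / mu2 n eps) * ip (slice_opt v - v) (slice_opt v - v) <=
    eps / 6 * B ^+ 2.
  rewrite -ipnorm_sqr (_ : L1 / mu2 n eps = 6 * sigma ^+ 2 / eps); last first.
    by rewrite sigma2 /mu2; field; rewrite !gt_eqF.
  have h1 : ipnorm ip (slice_opt v - v) ^+ 2 <= delta ^+ 2.
    by rewrite lerXn2r ?nnegrE ?ipnorm_ge0.
  have h2 := ler_wpM2l (sqr_ge0 sigma) h1.
  have E : sigma ^+ 2 * delta ^+ 2 = eps ^+ 2 * (delta * sigma / eps) ^+ 2.
    by field; rewrite gt_eqF.
  rewrite E in h2; rewrite /B; move: (delta * sigma / eps) ds0 h2 => X X0 h2.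
  have h3 : sigma ^+ 2 * ipnorm ip (slice_opt v - v) ^+ 2 / eps <= eps * X ^+ 2.
    by rewrite ler_pdivrMr //; apply: le_trans h2 _; rewrite expr2; lra.
  have h4 : 0 <= eps * X by rewrite mulr_ge0 // ltW.
  have -> : eps / 6 * (12 * X + 1) ^+ 2 = 24 * (eps * X ^+ 2) + 4 * (eps * X) + eps / 6.
    by field.
  have -> : 4 * (6 * sigma ^+ 2 / eps) * ipnorm ip (slice_opt v - v) ^+ 2 =
    24 * (sigma ^+ 2 * ipnorm ip (slice_opt v - v) ^+ 2 / eps) by ring.
  have := eps0; lra.
have hTB : 2 * B + 3 * kap%:R + 1 <= T%:R by rewrite /B; lra.
have [xk xkT hx] := fhat_agm_converges n0 hp hyp LW hL1 L10 mu20 Lest0 K1 K2 Lx B0 hip hTB.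
exists xk; first by rewrite /= mem_cat xkT orbT.
have Lk := fhat_agm_level n0 hp hyp LW hL1 L10 mu20 Lest0 K1 xkT.
have [Av vce _] := av; have [Ak ck] := level_affine Av Lk.
have kce : dot c xk < dot c e by rewrite ck.
have sk : slack xk = slack v by rewrite /slack ck.
have uk := slack_le Ak kce; rewrite radial_gap // sk; rewrite sk in uk.
have u0 : 0 < 1 - lmin xk by lra.
have f1 := fhat_ge_lambda_min n0 hp hyp (slice_opt v) mu20.
have f2 := fhat_le_lambda_min n0 hp hyp xk mu20.
have f3 := slice_opt_lmin av.
have f4 : mu2 n eps * ln n%:R = eps / 6 by rewrite /mu2; field; rewrite gt_eqF.
have f5 : eps * (1 / 3) <= eps * (1 - lmin xk) by rewrite ler_pM2l //; lra.
rewrite ler_pdivrMr //; lra.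
Qed.

Variable z1 : R.

(* When the diameter is infinite, only termination is claimed. *)
Definition solved_within (time : R -> R) v := forall ws xs g, exists2 t : nat,
  success (iter t step (start v ws xs g)) &
  forall d, Diam dot c Affine K ip z1 = d%:E -> t%:R <= time d.

(** With an infinite diameter the actual distance from v to [slice_opt v] serves as delta, so
    termination is still obtained. *)
Lemma phase_delta v : admissible v -> dot c v <= z1 -> exists delta, [/\ 0 <= delta,
  ipnorm ip (slice_opt v - v) <= delta &
  forall d, Diam dot c Affine K ip z1 = d%:E -> delta = d].
Proof.
move=> av vz; have h := diam_ge av vz; have g := ipnorm_ge0 ip (slice_opt v - v).
case: (Diam dot c Affine K ip z1) h => [d| |] // h.
  rewrite lee_fin in h; exists d; split=> //; first exact: le_trans h.
  by move=> d' [].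
by exists (ipnorm ip (slice_opt v - v)).
Qed.

Lemma solved_by_restart v (T0 : nat) (time time' : R -> R) :
  (forall ws xs g, (exists2 t, (t <= T0)%N & restarted v (iter t step (start v ws xs g))) \/
     success (iter T0 step (start v ws xs g))) ->
  (forall v', admissible v' -> dot c v' <= dot c v -> 3 / 2 * slack v <= slack v' ->
     solved_within time v') ->
  (forall d, Diam dot c Affine K ip z1 = d%:E -> T0%:R + time d <= time' d /\
     T0%:R <= time' d) ->
  solved_within time' v.
Proof.
move=> h hv ht ws xs g.
have [[t tT [v' [ws' [xs' [g' [a1 a2 a3 stE]]]]]]|hs] := h ws xs g; last first.
  by exists T0 => // d /ht[].
have [t' s' b'] := hv v' a1 a2 a3 ws' xs' g'.
exists (t' + t)%N; first by rewrite iterD stE.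
move=> d dE; have := b' d dE; have [hd _] := ht d dE.
have : (t%:R : R) <= T0%:R by rewrite ler_nat.
rewrite natrD; lra.
Qed.

Lemma solved_high v : admissible v -> dot c v <= z1 -> 1 / 2 < slack v ->
  solved_within success_time v.
Proof.
move=> av vz sv; have [delta [d0 hd hD]] := phase_delta av vz.
have ds0 : 0 <= delta * sigma / eps by rewrite divr_ge0 ?mulr_ge0 // ltW.
have q0 : 0 <= 24 * (delta * sigma / eps) + 3 + 3 * kap%:R.
  by have := ler0n R kap; lra.
have [T0 [hT1 hT2]] := nat_above q0.
(* Time 0 is allowed after a restart because none can occur: the new slack would exceed (3/2) (1/2)
   = 3/4, the maximum for a starting point. *)
apply: (@solved_by_restart v T0 (fun=> 0)) => [ws xs g|v' av' _ sv'|d /hD <-].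
- by apply: phase_succeeds av _ d0 hd hT1; lra.
- by have := slack_admissible av'; lra.
- by rewrite /success_time addr0; split; lra.
Qed.

Lemma solved_medium v : admissible v -> dot c v <= z1 -> 1 / 3 < slack v ->
  solved_within (fun d => 2 * success_time d) v.
Proof.
move=> av vz sv; have [delta [d0 hd hD]] := phase_delta av vz.
have ds0 : 0 <= delta * sigma / eps by rewrite divr_ge0 ?mulr_ge0 // ltW.
have kap0 : 0 <= 3 * kap%:R :> R by rewrite mulr_ge0 ?ler0n.
have q0 : 0 <= 24 * (delta * sigma / eps) + 3 + 3 * kap%:R.
  by lra.
have [T0 [hT1 hT2]] := nat_above q0.
(* A restart lifts the slack above (3/2) (1/3) = 1/2, hence at most one further phase. *)
apply: (@solved_by_restart v T0 success_time) => [ws xs g|v' av' vv' sv'|d /hD <-].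
- by apply: phase_succeeds av _ d0 hd hT1; lra.
- by apply: solved_high => //; [exact: le_trans vz|lra].
- by rewrite /success_time; split; lra.
Qed.

(** Induction on k, an upper bound on the restarts made while the slack is at most 1/3; each costs
    [restart_time], and the two last phases cost [success_time] each. *)
Lemma solved_all (k : nat) v : admissible v -> dot c v <= z1 ->
  1 / 3 < slack v * (3 / 2) ^+ k ->
  solved_within (fun d => k%:R * restart_time d + 2 * success_time d) v.
Proof.
have kap0 : 0 <= 3 * kap%:R :> R by rewrite mulr_ge0 ?ler0n.
elim: k v => [|k IH] v av vz sv.
  have := solved_medium av vz; rewrite expr0 mulr1 in sv => /(_ sv) h ws xs g.
  by have [t s b] := h ws xs g; exists t => // d /b; rewrite mul0r add0r.
have [delta [d0 hd hD]] := phase_delta av vz.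
have dse0 : 0 <= delta * sigma / eps by rewrite divr_ge0 ?mulr_ge0 // ltW.
have ds0 : 0 <= delta * sigma by rewrite mulr_ge0.
have [sv3|sv3] := ltP (1 / 3) (slack v).
  move=> ws xs g; have [t s b] := solved_medium av vz sv3 ws xs g.
  exists t => // d dE; apply: le_trans (b d dE) _; rewrite lerDr.
  by rewrite mulr_ge0 ?ler0n // -(hD d dE) /restart_time; lra.
have q0 : 0 <= 48 * (delta * sigma) + 3 + 3 * kap%:R by lra.
have [T0 [hT1 hT2]] := nat_above q0.
apply: (@solved_by_restart v T0 (fun d => k%:R * restart_time d + 2 * success_time d))
  => [ws xs g|v' av' vv' sv'|d /hD <-].
- by left; exact: phase_restarts av sv3 d0 hd hT1.
- apply: IH => //; first exact: le_trans vz.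
  apply: lt_le_trans sv _; rewrite exprS mulrA ler_wpM2r ?exprn_ge0 ?divr_ge0 //.
  by rewrite mulrC.
- have h1 : T0%:R <= restart_time delta by rewrite /restart_time; lra.
  have h2 : 0 <= k%:R * restart_time delta.
    by rewrite mulr_ge0 ?ler0n // (le_trans _ h1) ?ler0n.
  have h3 : 0 <= success_time delta by rewrite /success_time; lra.
  rewrite -[k.+1%:R]natr1 mulrDl mul1r; split; lra.
Qed.

End MainAlgorithm.

(** The factor 4 is two gradients per pass for each of the two methods; 1000 is a generous universal
    constant. *)
Lemma complexity_arith (R : realType) (t kap k : nat) (X Y La lr : R) :
  0 <= X -> 0 <= Y -> 0 <= La -> 0 <= lr ->
  kap%:R <= 2 + 2 * La -> k%:R <= 1 + 3 * lr ->
  t%:R <= k%:R * (48 * X + 4 + 3 * kap%:R) + 2 * (24 * Y + 4 + 3 * kap%:R) ->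
  (4 * t)%:R <= 1000 * (Y + (1 + lr) * (1 + X + La)).
Proof.
move=> X0 Y0 La0 lr0 hkap hk ht.
pose P := 1 + X + La; have P1 : 1 <= P by rewrite /P; lra.
have h1 : 48 * X + 4 + 3 * kap%:R <= 48 * P by rewrite /P; lra.
have h2 : k%:R * (48 * X + 4 + 3 * kap%:R) <= (1 + 3 * lr) * (48 * P).
  by rewrite ler_pM ?ler0n //; have := ler0n R kap; lra.
have h3 : 0 <= lr * P by rewrite mulr_ge0 //; lra.
have h4 : La <= P by rewrite /P; lra.
rewrite natrM -/P; lra.
Qed.


Theorem theorem4p4 (R : realType) :
  exists C : R, 0 < C /\
  forall (m n : nat) (p : mpoly.mpoly m R) (K : set 'rV[R]_m)
    (dot ip : {dot 'rV[R]_m for idfun}) (c : 'rV[R]_m)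
    (Affine : set 'rV[R]_m) (D : {vspace 'rV[R]_m}) (zstar : R) (e : 'rV[R]_m)
    (L1 eps Lest : R) (v1 : 'rV[R]_m),
  let L := level_space dot c D in
  let z1 := dot c v1 in
  let Dz1 := Diam dot c Affine K ip z1 in
  (2 <= n)%N ->
  hyperbolicity_cone p n K ->
  is_translate Affine D ->
  (exists2 d, d \in D & dot c d != 0) ->
  optimal_value dot c Affine K zstar ->
  Affine e -> K° e ->
  lip_const p e ip L = L1%:E -> 0 < L1 ->
  0 < eps < 1 -> 0 < Lest ->
  Affine v1 -> dot c v1 < dot c e -> lambda_min p e v1 = 1 / 4 ->
  exists t : nat,
    let run := main_run n p e ip L Lest eps v1 t in
    (exists2 xk, xk \in main_iters2 run &
       (dot c (radial_proj p e xk) - zstar) / (dot c e - zstar) <= eps) /\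
    ((main_grads run)%:R%:E <=
       C%:E * (Dz1 * (Num.sqrt (L1 * ln n%:R) / eps)%:E +
               (1 + ln ((dot c e - zstar) / (dot c e - z1)))%:E *
               (1 + Dz1 * (Num.sqrt (L1 * ln n%:R))%:E +
                `|ln (Lest / L1)|%:E)))%E.

Proof.
exists 1000; split; first by rewrite ltr0n.
move=> m n p K dot ip c Affine D zstar e L1 eps Lest v1 L z1 Dz1 n2 hK hA _ hopt Ae Ke
  hL1 L10 eps01 Lest0 Av1 v1ce lv1.
have n0 : (0 < n)%N by exact: ltnW.
have eps0 : 0 < eps by case/andP: eps01.
have Kv1 : K v1 by apply: (lambda_min_ge0_cone hK n0 Ke); rewrite lv1; lra.
have zce : zstar < dot c e by apply: le_lt_trans v1ce; exact: hopt.2.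
have av1 : admissible p dot c Affine e v1 by [].
have [kap [K1 K2 hkap]] := log2_ratio_exponent Lest0 L10.
pose r := (dot c e - zstar) / (dot c e - z1).
have gz : 0 < dot c e - z1 by rewrite subr_gt0.
have r1 : 1 <= r.
  by rewrite ler_pdivlMr // mul1r lerD2l lerN2; exact: hopt.2.
have lr0 : 0 <= ln r by exact: ln_ge0.
have [k [rk hk]] := growth_exponent r1.
(* The initial slack is 1 / r, so the product is at least 1. *)
have sr : 1 / 3 < slack dot c zstar e v1 * (3 / 2) ^+ k.
  have s0 : 0 < slack dot c zstar e v1 by apply: slack_gt0.
  have : slack dot c zstar e v1 * r = 1.
    by rewrite /slack /r; field; rewrite !gt_eqF // subr_gt0.
  have := ler_wpM2l (ltW s0) rk; lra.
have [t suc bound] := solved_all n2 hK hA hopt Ae Ke hL1 L10 eps01 Lest0 zce K1 K2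
  av1 (lexx z1) sr [::] [::] 0%N.
exists t; split; first exact: suc.
have -> : main_grads (main_run n p e ip L Lest eps v1 t) = (4 * t)%N.
  exact: main_grads_iter.
have sig0 : 0 < Num.sqrt (L1 * ln n%:R).
  by rewrite sqrtr_gt0 mulr_gt0 // ln_gt0 // ltr1n.
(* The slice of v1 meets K, so the diameter is not -oo and a finite value is nonnegative; if it is
   +oo, so is the claimed bound. *)
have := diam_ge ip n2 hK hA hopt Ae Ke zce av1 (lexx z1).
rewrite -/Dz1; case DE : Dz1 => [d| |] //= hd.
- have d0 : 0 <= d by rewrite lee_fin in hd; apply: le_trans hd; exact: ipnorm_ge0.
  rewrite -!(EFinM, EFinD) lee_fin mulrA.
  apply: (complexity_arith _ _ _ _ hkap hk (bound d DE)) => //.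
  + by rewrite mulr_ge0 // ltW.
  + by rewrite divr_ge0 ?mulr_ge0 // ltW.
- rewrite gt0_mulye ?lte_fin ?divr_gt0 //.
  rewrite gt0_mulye ?lte_fin //.
  rewrite (_ : (1 + +oo + _)%E = +oo%E) // gt0_muley ?lte_fin ?ltr0n //.
    exact: leey.
  by rewrite -/r; lra.
Qed.
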